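(* Let $z_0\in T$ and $k\in\{0,1,2,\dots\}\cup\{\infty\}$. Then $U_3(T,z_0,k)$ is a dense $G_\delta$ subset of $C^k(T)$.
   Context: $D=\{|z|<1\}$, $T=\{|z|=1\}$, $D(z_0,r)$ the open disk of center $z_0$ and radius $r$. For $k\in\{0,1,2,\dots\}\cup\{\infty\}$, $C^k(T)$ is the space of $u:T\to\mathbb{C}$ such that $\theta\mapsto u(e^{i\theta})$ is $k$ times continuously differentiable on $\mathbb{R}$, with the topology given by the seminorms $\sup_{\theta\in\mathbb{R}}|\frac{d^l}{d\theta^l}u(e^{i\theta})|$ for all integers $0\le l\le k$. For $z_0\in T$ and $r>0$ put $P(z_0,r)=D(z_0,r)\cap D$. $U_3(T,z_0,k)$ is the set of $u\in C^k(T)$ for which there exist no $r>0$ and no continuous $h:T\cup P(z_0,r)\to\mathbb{C}$ holomorphic on $P(z_0,r)$ with $h=u$ on $D(z_0,r)\cap T$. *)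

(* Defs.v *)
From Stdlib Require Import Reals.
Open Scope R_scope.

Definition Cx : Type := (R * R)%type.
Definition Cadd (z w : Cx) : Cx := (fst z + fst w, snd z + snd w).
Definition Csub (z w : Cx) : Cx := (fst z - fst w, snd z - snd w).
Definition Cmul (z w : Cx) : Cx :=
  (fst z * fst w - snd z * snd w, fst z * snd w + snd z * fst w).
Definition Cmod (z : Cx) : R := sqrt (fst z ^ 2 + snd z ^ 2).

Definition cexpi (t : R) : Cx := (cos t, sin t).

Definition onT (z : Cx) : Prop := Cmod z = 1.
Definition inD (z : Cx) : Prop := Cmod z < 1.
Definition inDisk (z0 : Cx) (r : R) (z : Cx) : Prop := Cmod (Csub z z0) < r.
Definition inP (z0 : Cx) (r : R) (z : Cx) : Prop := inDisk z0 r z /\ inD z.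

Definition cont_on (S : Cx -> Prop) (h : Cx -> Cx) : Prop :=
  forall z, S z -> forall eps, 0 < eps -> exists delta, 0 < delta /\
    forall w, S w -> Cmod (Csub w z) < delta -> Cmod (Csub (h w) (h z)) < eps.

Definition holo_on (S : Cx -> Prop) (h : Cx -> Cx) : Prop :=
  forall z, S z -> exists l : Cx, forall eps, 0 < eps -> exists delta, 0 < delta /\
    forall w, Cmod (Csub w z) < delta ->
      Cmod (Csub (Csub (h w) (h z)) (Cmul l (Csub w z))) <= eps * Cmod (Csub w z).

Inductive ext_nat : Type := Fin (n : nat) | Inf.
Definition le_ext (j : nat) (k : ext_nat) : Prop :=
  match k with Fin n => (j <= n)%nat | Inf => True end.

(** A function u : T -> Cx is represented by g : R -> Cx, g theta = u (e^{i theta});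
    such g are exactly the 2π-periodic functions. *)
Definition periodic (g : R -> Cx) : Prop := forall t, g (t + 2 * PI) = g t.

Definition derivs (k : ext_nat) (g : R -> Cx) (d : nat -> R -> Cx) : Prop :=
  d O = g /\
  (forall j, le_ext (S j) k -> forall t,
      derivable_pt_lim (fun s => fst (d j s)) t (fst (d (S j) t)) /\
      derivable_pt_lim (fun s => snd (d j s)) t (snd (d (S j) t))) /\
  (forall j, le_ext j k ->
      continuity (fun s => fst (d j s)) /\ continuity (fun s => snd (d j s))).

Definition Ck (k : ext_nat) (g : R -> Cx) : Prop :=
  periodic g /\ exists d, derivs k g d.

(** Closed ball of radius eps for the seminorms of order j <= N
    (sup_theta |d^j/dtheta^j (f - g)| <= eps for all j <= N).
    Derivatives are unique, so quantifying over all derivative sequences is harmless. *)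
Definition near (k : ext_nat) (N : nat) (eps : R) (f g : R -> Cx) : Prop :=
  forall df dg, derivs k f df -> derivs k g dg ->
    forall j, (j <= N)%nat -> forall t, Cmod (Csub (df j t) (dg j t)) <= eps.

Definition Ck_open (k : ext_nat) (O : (R -> Cx) -> Prop) : Prop :=
  forall g, Ck k g -> O g ->
    exists N eps, le_ext N k /\ 0 < eps /\
      forall f, Ck k f -> near k N eps f g -> O f.

Definition Ck_dense (k : ext_nat) (A : (R -> Cx) -> Prop) : Prop :=
  (forall g, A g -> Ck k g) /\
  forall g, Ck k g -> forall N eps, le_ext N k -> 0 < eps ->
    exists f, A f /\ near k N eps f g.

Definition Ck_Gdelta (k : ext_nat) (A : (R -> Cx) -> Prop) : Prop :=
  exists O : nat -> (R -> Cx) -> Prop, (forall n, Ck_open k (O n)) /\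
    forall g, Ck k g -> (A g <-> forall n, O n g).

Definition U3 (z0 : Cx) (k : ext_nat) (g : R -> Cx) : Prop :=
  Ck k g /\
  ~ (exists (r : R) (h : Cx -> Cx), 0 < r /\
       cont_on (fun z => onT z \/ inP z0 r z) h /\
       holo_on (inP z0 r) h /\
       forall t, inDisk z0 r (cexpi t) -> h (cexpi t) = g t).

(* Main.v *)
(** The heart of the matter is a maximum principle for functions [h] that are holomorphic on the
    circular segment [{|z| < 1, <z,a> > 1 - d}] and continuous up to its boundary. Multiplying [h]
    by [exp (lam z conj(a))], whose modulus depends only on [<z,a>], gives a two-constants estimate:
    if [h] is bounded and small on the arc, it is small on a smaller segment.

    Write the complement of [U3] as the union over [n] of the sets [E n] of functions having an
    extension bounded by [n] to the segment of height [1 / (n + 1)]. If functions in [E n] converge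
    uniformly, the two-constants estimate makes their extensions converge uniformly on the segment
    of half the height, so the closure of [E n] misses [U3], which is thus a G_delta.

    Density: a smooth function that vanishes on one side of [z0] only has no extension, since an
    extension would vanish on a small segment, hence everywhere. If [g] is not in [U3], adding a
    small multiple of such a function puts it there. *)
Require Import Defs.
From Stdlib Require Import Reals Lra Lia Psatz ClassicalEpsilon.
From Coquelicot Require Import Coquelicot.
Open Scope R_scope.

(** * Goursat's theorem on rectangles *)

(** [U3] speaks of functions continuous on all of T and on P(z0,r), whereas the estimates live on
    segments. From disc to segment one restricts; back, the extension is composed with a Lipschitz
    retraction of the closed disc onto the segment, which supplies values on the rest of T.

    The function theory rests on Goursat alone. In a logarithmic coordinate around a point it makes
    circle averages independent of the radius, which yields the mean value inequality even at a
    centre where only continuity is known. This tolerance lets the maximum principle act on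
    difference quotients, and bounds on these replace Cauchy's estimates: they give holomorphy of
    uniform limits, and spread zeros from a small disc to a large one without power series.

    The closure argument uses only the sup norm, a seminorm of every C^k(T), so it is the same for
    all k. Density needs no category argument: extendable functions form a vector space, so an
    extendable function plus a nonzero multiple of a non-extendable one is not extendable. *)

Lemma geometric_half_small (a : R) : 0 < a -> forall L, exists n, L * (/ 2) ^ n < a.
Proof.
  intros Ha L.
  destruct (pow_lt_1_zero (/ 2) ltac:(rewrite Rabs_pos_eq; lra) (a / (Rabs L + 1)))
    as [n Hn].
  { apply Rdiv_lt_0_compat; [lra|]. pose proof (Rabs_pos L); lra. }
  exists n. specialize (Hn n (le_n n)).
  rewrite Rabs_pos_eq in Hn by (apply pow_le; lra).
  pose proof (Rabs_pos L). pose proof (Rle_abs L).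
  apply Rmult_lt_compat_r with (r := Rabs L + 1) in Hn; [|lra].
  unfold Rdiv in Hn. rewrite Rmult_assoc, Rinv_l, Rmult_1_r in Hn by lra.
  assert (0 < (/ 2) ^ n) by (apply pow_lt; lra). nra.
Qed.

Lemma RInt_Rplus (f g : R -> R) (a b : R) : ex_RInt f a b -> ex_RInt g a b ->
  RInt (fun x => f x + g x) a b = RInt f a b + RInt g a b.
Proof. exact (RInt_plus f g a b). Qed.

Lemma RInt_Rminus (f g : R -> R) (a b : R) : ex_RInt f a b -> ex_RInt g a b ->
  RInt (fun x => f x - g x) a b = RInt f a b - RInt g a b.
Proof. exact (RInt_minus f g a b). Qed.

Lemma RInt_Rconst (K a b : R) : RInt (fun _ => K) a b = K * (b - a).
Proof. rewrite RInt_const. unfold scal; simpl; unfold mult; simpl. ring. Qed.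

Lemma RInt_near_const (f : R -> R) (a b K e : R) : a <= b ->
  (forall x, a <= x <= b -> continuous f x) ->
  (forall x, a <= x <= b -> Rabs (f x - K) <= e) ->
  Rabs (RInt f a b - K * (b - a)) <= e * (b - a).
Proof.
  intros Hab Hc He.
  assert (Hi : ex_RInt f a b).
  { apply @ex_RInt_continuous. intros x Hx. apply Hc.
    rewrite Rmin_left, Rmax_right in Hx by lra. exact Hx. }
  rewrite <- RInt_Rconst, <- RInt_Rminus by (exact Hi || apply @ex_RInt_const).
  replace (e * (b - a)) with ((b - a) * e) by ring.
  apply abs_RInt_le_const; [exact Hab| |].
  - apply @ex_RInt_minus; [exact Hi|apply @ex_RInt_const].
  - intros t Ht. exact (He t Ht).
Qed.

Lemma differentiable_continuous_x (f : R -> R -> R) (x y lx ly : R) :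
  differentiable_pt_lim f x y lx ly -> continuous (fun s => f s y) x.
Proof.
  intros H. assert (C := differentiable_continuity_pt f x y (ex_intro _ lx (ex_intro _ ly H))).
  apply filterlim_locally. intros eps.
  destruct (C eps) as [d Hd]. exists d. intros s Hs. apply Hd; [exact Hs|].
  rewrite Rminus_diag, Rabs_R0. apply cond_pos.
Qed.

Lemma differentiable_continuous_y (f : R -> R -> R) (x y lx ly : R) :
  differentiable_pt_lim f x y lx ly -> continuous (fun s => f x s) y.
Proof.
  intros H. assert (C := differentiable_continuity_pt f x y (ex_intro _ lx (ex_intro _ ly H))).
  apply filterlim_locally. intros eps.
  destruct (C eps) as [d Hd]. exists d. intros s Hs. apply Hd; [|exact Hs].
  rewrite Rminus_diag, Rabs_R0. apply cond_pos.
Qed.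

Section Goursat.
Variables (X : R) (u v : R -> R -> R).
Hypothesis CR : forall x y, x < X -> exists ux uy vx,
  differentiable_pt_lim u x y ux uy /\ differentiable_pt_lim v x y vx ux.

(* The integral of [v dx + u dy] along the boundary of the rectangle; this form is closed as soon
   as [u_x = v_y], so only one of the Cauchy-Riemann equations is needed. *)
Let G a b c d := RInt (fun x => v x c - v x d) a b + RInt (fun y => u b y - u a y) c d.

Lemma CR_cont x y : x < X ->
  continuous (fun s => u s y) x /\ continuous (fun s => u x s) y /\
  continuous (fun s => v s y) x /\ continuous (fun s => v x s) y.
Proof.
  intros Hx. destruct (CR x y Hx) as (ux & uy & vx & Hu & Hv).
  split; [|split; [|split]].
  - exact (differentiable_continuous_x _ _ _ _ _ Hu).
  - exact (differentiable_continuous_y _ _ _ _ _ Hu).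
  - exact (differentiable_continuous_x _ _ _ _ _ Hv).
  - exact (differentiable_continuous_y _ _ _ _ _ Hv).
Qed.

Lemma cont_dv x c d : x < X -> continuous (fun x => v x c - v x d) x.
Proof.
  intros Hx. apply @continuous_minus; [apply (CR_cont x c Hx)|apply (CR_cont x d Hx)].
Qed.

Lemma cont_du a b y : a < X -> b < X -> continuous (fun y => u b y - u a y) y.
Proof.
  intros Ha Hb. apply @continuous_minus; [apply (CR_cont b y Hb)|apply (CR_cont a y Ha)].
Qed.

Lemma ex_dv a b c d : a < X -> b < X -> ex_RInt (fun x => v x c - v x d) a b.
Proof.
  intros Ha Hb. apply @ex_RInt_continuous. intros x Hx. apply cont_dv.
  destruct Hx as [_ Hx]. apply Rle_lt_trans with (1 := Hx). apply Rmax_lub_lt; lra.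
Qed.

Lemma ex_du a b c d : a < X -> b < X -> ex_RInt (fun y => u b y - u a y) c d.
Proof.
  intros Ha Hb. apply @ex_RInt_continuous. intros y _. apply cont_du; assumption.
Qed.

Lemma G_split_x a m b c d : a < X -> m < X -> b < X -> G a b c d = G a m c d + G m b c d.
Proof.
  intros Ha Hm Hb. unfold G.
  rewrite <- (RInt_Chasles (fun x => v x c - v x d) a m b) by (apply ex_dv; assumption).
  rewrite (RInt_ext (fun y => u b y - u a y)
             (fun y => (u m y - u a y) + (u b y - u m y))).
  2:{ intros y _. simpl. ring. }
  rewrite RInt_Rplus by (apply ex_du; assumption).
  unfold plus; simpl. ring.
Qed.

Lemma G_split_y a b c m d : a < X -> b < X -> G a b c d = G a b c m + G a b m d.
Proof.
  intros Ha Hb. unfold G.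
  rewrite <- (RInt_Chasles (fun y => u b y - u a y) c m d) by (apply ex_du; assumption).
  rewrite (RInt_ext (fun x => v x c - v x d)
             (fun x => (v x c - v x m) + (v x m - v x d))).
  2:{ intros y _. simpl. ring. }
  rewrite RInt_Rplus by (apply ex_dv; assumption).
  unfold plus; simpl. ring.
Qed.

(** Nondegeneracy and the bound by [X] travel with the rectangle, so that halving is a total map
    that can be iterated. *)
Record rect := Rect { ra : R; rb : R; rc : R; rd : R;
  rab : ra < rb; rcd : rc < rd; rbX : rb < X }.
Let GG (s : rect) := Rabs (G (ra s) (rb s) (rc s) (rd s)).

(** [G] is additive under a cut, so one of the two pieces carries at least half of its absolute
    value. One cut in each direction gives the factor 4. *)
Lemma G_half (s : rect) : exists s' : rect,
  (ra s <= ra s' /\ rb s' <= rb s /\ rc s <= rc s' /\ rd s' <= rd s) /\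
  rb s' - ra s' = (rb s - ra s) / 2 /\ rd s' - rc s' = (rd s - rc s) / 2 /\
  GG s <= 4 * GG s'.
Proof.
  destruct s as [a b c d Hab Hcd HbX]. unfold GG; simpl.
  assert (E : forall A B, Rabs (A + B) <= 2 * Rabs A \/ Rabs (A + B) <= 2 * Rabs B).
  { intros A B. pose proof (Rabs_triang A B).
    destruct (Rle_dec (Rabs A) (Rabs B)); [right|left]; lra. }
  assert (Hx : exists a' b', a <= a' /\ a' < b' /\ b' <= b /\ b' - a' = (b - a) / 2 /\
    Rabs (G a b c d) <= 2 * Rabs (G a' b' c d)).
  { rewrite (G_split_x a ((a + b) / 2) b c d) by lra.
    destruct (E (G a ((a + b) / 2) c d) (G ((a + b) / 2) b c d)) as [H|H].
    - exists a, ((a + b) / 2). repeat split; try lra; exact H.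
    - exists ((a + b) / 2), b. repeat split; try lra; exact H. }
  destruct Hx as (a' & b' & H1 & H2 & H3 & H4 & H5).
  assert (Hy : exists c' d', c <= c' /\ c' < d' /\ d' <= d /\ d' - c' = (d - c) / 2 /\
    Rabs (G a' b' c d) <= 2 * Rabs (G a' b' c' d')).
  { rewrite (G_split_y a' b' c ((c + d) / 2) d) by lra.
    destruct (E (G a' b' c ((c + d) / 2)) (G a' b' ((c + d) / 2) d)) as [H|H].
    - exists c, ((c + d) / 2). repeat split; try lra; exact H.
    - exists ((c + d) / 2), d. repeat split; try lra; exact H. }
  destruct Hy as (c' & d' & K1 & K2 & K3 & K4 & K5).
  exists (Rect a' b' c' d' H2 K2 (Rle_lt_trans _ _ _ H3 HbX)). simpl.
  repeat split; try assumption. lra.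
Qed.

Let half (s : rect) : rect := proj1_sig (constructive_indefinite_description _ (G_half s)).
Let halfP s := proj2_sig (constructive_indefinite_description _ (G_half s)).

Let it (s : rect) (n : nat) : rect := Nat.iter n half s.

Lemma it_step s n : let r := it s n in let r' := it s (S n) in
  (ra r <= ra r' /\ rb r' <= rb r /\ rc r <= rc r' /\ rd r' <= rd r) /\
  rb r' - ra r' = (rb r - ra r) / 2 /\ rd r' - rc r' = (rd r - rc r) / 2 /\
  GG r <= 4 * GG r'.
Proof. exact (halfP (it s n)). Qed.

Lemma it_size s n :
  rb (it s n) - ra (it s n) = (rb s - ra s) * (/ 2) ^ n /\
  rd (it s n) - rc (it s n) = (rd s - rc s) * (/ 2) ^ n /\
  GG s <= 4 ^ n * GG (it s n).
Proof.
  induction n as [|n (I1 & I2 & I3)].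
  - simpl. lra.
  - destruct (it_step s n) as (_ & H1 & H2 & H3).
    rewrite H1, H2, I1, I2. split; [|split].
    + simpl. field.
    + simpl. field.
    + apply Rle_trans with (1 := I3). simpl pow.
      assert (0 < 4 ^ n) by (apply pow_lt; lra).
      apply Rmult_le_compat_l with (r := 4 ^ n) in H3; lra.
Qed.

Lemma it_mono s n m :
  ra (it s n) <= ra (it s (m + n)) /\ rb (it s (m + n)) <= rb (it s n) /\
  rc (it s n) <= rc (it s (m + n)) /\ rd (it s (m + n)) <= rd (it s n).
Proof.
  induction m as [|m IH]; [simpl; lra|].
  destruct (it_step s (m + n)) as (H & _). change (S m + n)%nat with (S (m + n)). lra.
Qed.

Lemma nested_point (a b : nat -> R) :
  (forall n m, a n <= b m) -> exists x, forall n, a n <= x <= b n.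
Proof.
  intros H.
  destruct (completeness (fun y => exists n, y = a n)) as [x [Hx1 Hx2]].
  - exists (b O). intros y [n ->]. apply H.
  - exists (a O), O. reflexivity.
  - exists x. intros n. split; [apply Hx1; exists n; reflexivity|].
    apply Hx2. intros y [m ->]. apply H.
Qed.

Lemma it_point s : exists x y, forall n,
  ra (it s n) <= x <= rb (it s n) /\ rc (it s n) <= y <= rd (it s n).
Proof.
  assert (M : forall n m, ra (it s n) <= rb (it s m) /\ rc (it s n) <= rd (it s m)).
  { intros n m. destruct (it_mono s n m) as (H1 & _ & H3 & _).
    destruct (it_mono s m n) as (_ & H2 & _ & H4).
    rewrite Nat.add_comm in H1, H3.
    pose proof (rab (it s (n + m))). pose proof (rcd (it s (n + m))). lra. }
  destruct (nested_point (fun n => ra (it s n)) (fun n => rb (it s n))) as [x Hx].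
  { intros; apply M. }
  destruct (nested_point (fun n => rc (it s n)) (fun n => rd (it s n))) as [y Hy].
  { intros; apply M. }
  exists x, y. auto.
Qed.

(** The halved rectangles shrink to a point where [u] and [v] are differentiable. The affine parts
    there contribute nothing, because u_x = v_y; the remainder is o(size^2), which beats the factor
    4^n lost in n halvings. *)
Lemma goursat_rect a b c d : a < b -> c < d -> b < X -> G a b c d = 0.
Proof.
  intros Hab Hcd HbX. set (s := Rect a b c d Hab Hcd HbX).
  set (L := (b - a) + (d - c)).
  assert (HL : 0 < L) by (unfold L; lra).
  assert (Hs : forall e, 0 < e -> GG s <= e).
  2:{ destruct (Req_dec (G a b c d) 0) as [E|E]; [exact E|].
      apply Rabs_pos_lt in E. specialize (Hs (Rabs (G a b c d) / 2)).
      unfold GG in Hs; simpl in Hs. lra. }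
  intros e He. destruct (it_point s) as (x & y & Hxy).
  assert (HxX : x < X). { apply Rle_lt_trans with b; [apply (Hxy O)|exact HbX]. }
  destruct (CR x y HxX) as (ux & uy & vx & Hu & Hv).
  (* Chosen so that the final bound 4 k L^2 is [e]. *)
  set (k := e / (4 * L * L)).
  assert (Hk : 0 < k). { apply Rdiv_lt_0_compat; nra. }
  destruct (Hu (mkposreal k Hk)) as [d1 D1]. destruct (Hv (mkposreal k Hk)) as [d2 D2].
  simpl in D1, D2.
  destruct (geometric_half_small (Rmin d1 d2)) with (L := L) as [n Hn].
  { apply Rmin_glb_lt; apply cond_pos. }
  destruct (it_size s n) as (S1 & S2 & S3). specialize (Hxy n).
  apply Rle_trans with (1 := S3).
  assert (HbXn := rbX (it s n)).
  assert (Hq : 0 < (/ 2) ^ n) by (apply pow_lt; lra).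
  assert (H4 : 4 ^ n * ((/ 2) ^ n * (/ 2) ^ n) = 1).
  { rewrite <- !Rpow_mult_distr. replace (4 * (/ 2 * / 2)) with 1 by field. apply pow1. }
  unfold GG. revert S1 S2 Hxy HbXn. generalize (it s n). intros [a' b' c' d' Ha Hc Hb]. simpl.
  intros S1 S2 Hxy _. set (q := (/ 2) ^ n) in *. fold L in Hn.
  assert (HLq1 : b' - a' <= L * q) by (rewrite S1; unfold L; nra).
  assert (HLq2 : d' - c' <= L * q) by (rewrite S2; unfold L; nra).
  pose proof (Rmin_l d1 d2). pose proof (Rmin_r d1 d2).
  assert (D1' : forall p r, a' <= p <= b' -> c' <= r <= d' ->
    Rabs (u p r - u x y - (ux * (p - x) + uy * (r - y))) <= k * (L * q) /\
    Rabs (v p r - v x y - (vx * (p - x) + ux * (r - y))) <= k * (L * q)).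
  { intros p r Hp Hr.
    assert (B1 : Rabs (p - x) <= L * q) by (apply Rabs_le; lra).
    assert (B2 : Rabs (r - y) <= L * q) by (apply Rabs_le; lra).
    assert (B3 := Rmax_lub _ _ _ B1 B2).
    split.
    - apply Rle_trans with (1 := D1 p r ltac:(lra) ltac:(lra)).
      apply Rmult_le_compat_l; [lra|exact B3].
    - apply Rle_trans with (1 := D2 p r ltac:(lra) ltac:(lra)).
      apply Rmult_le_compat_l; [lra|exact B3]. }
  (* To first order the two integrands are the constants [- (ux * (d' - c'))] and [ux * (b' - a')],
     whose integrals over the sides cancel; the error doubles because each integrand is a difference
     of two values. *)
  assert (I1 := RInt_near_const (fun x => v x c' - v x d') a' b' (- (ux * (d' - c')))
    (2 * (k * (L * q))) ltac:(lra)
    ltac:(intros t Ht; apply cont_dv; lra)).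
  assert (I2 := RInt_near_const (fun y => u b' y - u a' y) c' d' (ux * (b' - a'))
    (2 * (k * (L * q))) ltac:(lra)
    ltac:(intros t Ht; apply cont_du; lra)).
  assert (J1 : forall t, a' <= t <= b' ->
    Rabs (v t c' - v t d' - - (ux * (d' - c'))) <= 2 * (k * (L * q))).
  { intros t Ht. destruct (D1' t c') as [_ E1]; [lra|lra|].
    destruct (D1' t d') as [_ E2]; [lra|lra|].
    apply Rabs_le_between in E1. apply Rabs_le_between in E2. apply Rabs_le. lra. }
  assert (J2 : forall t, c' <= t <= d' ->
    Rabs (u b' t - u a' t - ux * (b' - a')) <= 2 * (k * (L * q))).
  { intros t Ht. destruct (D1' b' t) as [E1 _]; [lra|lra|].
    destruct (D1' a' t) as [E2 _]; [lra|lra|].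
    apply Rabs_le_between in E1. apply Rabs_le_between in E2. apply Rabs_le. lra. }
  specialize (I1 J1). specialize (I2 J2).
  assert (HG : Rabs (G a' b' c' d') <= 4 * k * (L * q) * (L * q)).
  { unfold G. apply Rabs_le_between in I1. apply Rabs_le_between in I2.
    assert (0 < k * (L * q)) by (apply Rmult_lt_0_compat; nra).
    apply Rabs_le. split; nra. }
  apply Rle_trans with (4 ^ n * (4 * k * (L * q) * (L * q))).
  { apply Rmult_le_compat_l; [apply pow_le; lra|exact HG]. }
  replace (4 ^ n * (4 * k * (L * q) * (L * q))) with ((4 ^ n * (q * q)) * (4 * k * L * L)) by ring.
  rewrite H4. unfold k. right. field. lra.
Qed.

End Goursat.

(** The horizontal sides cancel pointwise since [v] agrees at heights 0 and [T]; Goursat's theorem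
    then compares the two vertical sides. *)
Lemma goursat_periodic (X : R) (u v : R -> R -> R) :
  (forall x y, x < X -> exists ux uy vx,
    differentiable_pt_lim u x y ux uy /\ differentiable_pt_lim v x y vx ux) ->
  forall T, 0 < T -> (forall x, v x 0 = v x T) ->
  forall a b, a < b -> b < X ->
  RInt (u a) 0 T = RInt (u b) 0 T.
Proof.
  intros CR T HT Hper a b Hab HbX.
  assert (Gz := goursat_rect X u v CR a b 0 T Hab HT HbX). simpl in Gz.
  rewrite (RInt_ext (fun x => v x 0 - v x T) (fun _ => 0)) in Gz.
  2:{ intros x _. rewrite Hper. apply Rminus_diag. }
  rewrite RInt_Rconst, Rmult_0_l, Rplus_0_l, RInt_Rminus in Gz; [symmetry; apply Rminus_diag_uniq; exact Gz| |];
    apply @ex_RInt_continuous; intros y _; apply (CR_cont X u v CR); lra.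
Qed.

(** * Complex differentiability and the mean value property *)

(** Convertible with the condition inside [holo_on], so that the two are interchanged without a
    lemma; [cdiff_is_derive] gives access to the calculus rules of [is_derive]. *)
Definition cdiff (h : C -> C) (z l : C) : Prop :=
  forall eps, 0 < eps -> exists delta, 0 < delta /\
    forall w : C, Cmod (w - z) < delta ->
      Cmod (h w - h z - l * (w - z)) <= eps * Cmod (w - z).

Definition ccont (h : C -> C) (z : C) : Prop :=
  forall eps, 0 < eps -> exists delta, 0 < delta /\
    forall w : C, Cmod (w - z) < delta -> Cmod (h w - h z) < eps.

Notation is_Cderive := (@is_derive C_AbsRing (AbsRing_NormedModule C_AbsRing)).

Lemma cdiff_is_derive (h : C -> C) (z l : C) : cdiff h z l <-> is_Cderive h z l.
Proof.
  split.
  - intros H. split; [apply is_linear_scal_l|].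
    intros x Hx. apply (is_filter_lim_locally_unique (V := AbsRing_NormedModule C_AbsRing)) in Hx. rewrite <- Hx.
    intros eps. destruct (H eps (cond_pos eps)) as (d & Hd & Hw).
    exists (mkposreal d Hd). intros w Bw. change (Cmod (w - z) < d) in Bw.
    specialize (Hw w Bw). rewrite (Cmult_comm l) in Hw. exact Hw.
  - intros [_ H] eps He.
    destruct (H z (fun P HP => HP) (mkposreal eps He)) as [d Hd].
    exists d. split; [apply cond_pos|]. intros w Bw. specialize (Hd w Bw).
    rewrite (Cmult_comm l). exact Hd.
Qed.

Lemma cdiff_const (c z : C) : cdiff (fun _ => c) z 0.
Proof. apply cdiff_is_derive. exact (is_derive_const (V := AbsRing_NormedModule C_AbsRing) c z). Qed.

Lemma cdiff_id (z : C) : cdiff (fun w => w) z 1.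
Proof. apply cdiff_is_derive. exact (@is_derive_id C_AbsRing z). Qed.

Lemma cdiff_plus (f g : C -> C) (z lf lg : C) :
  cdiff f z lf -> cdiff g z lg -> cdiff (fun w => f w + g w)%C z (lf + lg)%C.
Proof.
  intros Hf Hg. apply cdiff_is_derive in Hf, Hg. apply cdiff_is_derive.
  exact (is_derive_plus (V := AbsRing_NormedModule C_AbsRing) _ _ _ _ _ Hf Hg).
Qed.

Lemma cdiff_mult (f g : C -> C) (z lf lg : C) :
  cdiff f z lf -> cdiff g z lg ->
  cdiff (fun w => f w * g w)%C z (lf * g z + f z * lg)%C.
Proof.
  intros Hf Hg. apply cdiff_is_derive in Hf, Hg. apply cdiff_is_derive.
  exact (@is_derive_mult C_AbsRing _ _ _ _ _ Hf Hg Cmult_comm).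
Qed.

Lemma cdiff_comp (f g : C -> C) (z lf lg : C) :
  cdiff f (g z) lf -> cdiff g z lg -> cdiff (fun w => f (g w)) z (lg * lf)%C.
Proof.
  intros Hf Hg. apply cdiff_is_derive in Hf, Hg. apply cdiff_is_derive.
  exact (is_derive_comp (V := AbsRing_NormedModule C_AbsRing) _ _ _ _ _ Hf Hg).
Qed.

Lemma cdiff_ext (f g : C -> C) (z l : C) (r : R) : 0 < r ->
  (forall w, Cmod (w - z) < r -> f w = g w) -> cdiff f z l -> cdiff g z l.
Proof.
  intros Hr E H eps He. destruct (H eps He) as (d & Hd & K).
  exists (Rmin d r). split; [apply Rmin_glb_lt; assumption|].
  intros w Hw. rewrite <- !E.
  - apply K. apply Rlt_le_trans with (1 := Hw). apply Rmin_l.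
  - unfold Cminus. rewrite Cplus_opp_r, Cmod_0. exact Hr.
  - apply Rlt_le_trans with (1 := Hw). apply Rmin_r.
Qed.

Lemma cdiff_cont (h : C -> C) (z l : C) : cdiff h z l -> ccont h z.
Proof.
  intros H eps He. destruct (H 1 Rlt_0_1) as (d & Hd & K).
  assert (Hq : 0 < eps / (Cmod l + 1)).
  { apply Rdiv_lt_0_compat; [exact He|]. pose proof (Cmod_ge_0 l); lra. }
  exists (Rmin d (eps / (Cmod l + 1))). split; [apply Rmin_glb_lt; assumption|].
  intros w Hw.
  assert (W1 : Cmod (w - z) < d) by (apply Rlt_le_trans with (1 := Hw); apply Rmin_l).
  assert (W2 : Cmod (w - z) < eps / (Cmod l + 1))
    by (apply Rlt_le_trans with (1 := Hw); apply Rmin_r).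
  replace (h w - h z)%C with ((h w - h z - l * (w - z)) + l * (w - z))%C by ring.
  apply Rle_lt_trans with (1 := Cmod_triangle _ _). rewrite Cmod_mult.
  pose proof (K w W1). pose proof (Cmod_ge_0 l).
  apply (Rmult_lt_compat_l (Cmod l + 1)) in W2; [|lra].
  replace ((Cmod l + 1) * (eps / (Cmod l + 1))) with eps in W2 by (field; lra). nra.
Qed.

Lemma Cmod_rev_triangle (a b : C) : Cmod a - Cmod b <= Cmod (a - b).
Proof.
  replace a with ((a - b) + b)%C at 1 by ring.
  pose proof (Cmod_triangle (a - b) b). lra.
Qed.

Lemma Cmod_sub_sym (a b : C) : Cmod (a - b) = Cmod (b - a).
Proof. rewrite <- Cmod_opp. f_equal. ring. Qed.

Lemma Cmod_sub_triangle (a b c : C) : Cmod (a - c) <= Cmod (a - b) + Cmod (b - c).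
Proof.
  replace (a - c)%C with ((a - b) + (b - c))%C by ring. apply Cmod_triangle.
Qed.

Lemma Cmod_sqr (z : C) : Cmod z * Cmod z = fst z * fst z + snd z * snd z.
Proof. unfold Cmod. rewrite sqrt_sqrt; [ring|nra]. Qed.

Lemma Cmod_le_abs (z : C) : Cmod z <= Rabs (fst z) + Rabs (snd z).
Proof.
  pose proof (Cmod_ge_0 z). pose proof (Rabs_pos (fst z)). pose proof (Rabs_pos (snd z)).
  pose proof (Cmod_sqr z). pose proof (Rsqr_abs (fst z)). pose proof (Rsqr_abs (snd z)).
  unfold Rsqr in *. nra.
Qed.

Lemma abs_fst_le (z : C) : Rabs (fst z) <= Cmod z.
Proof. apply Rle_trans with (2 := Rmax_Cmod z). apply Rmax_l. Qed.

Lemma abs_snd_le (z : C) : Rabs (snd z) <= Cmod z.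
Proof. apply Rle_trans with (2 := Rmax_Cmod z). apply Rmax_r. Qed.

Lemma cdiff_inv (z : C) : z <> 0 -> cdiff Cinv z (- / (z * z))%C.
Proof.
  intros Hz eps He. assert (Mz : 0 < Cmod z) by (apply Cmod_gt_0; exact Hz).
  (* The error is (w - z)^2 / (w z^2). With |w| > |z| / 2 it is at most eps |w - z| once |w - z| <=
     [k]. *)
  set (k := Cmod z * Cmod z * Cmod z * eps / 2).
  assert (Hk : 0 < k).
  { unfold k. apply Rdiv_lt_0_compat; [|lra]. repeat apply Rmult_lt_0_compat; assumption. }
  exists (Rmin (Cmod z / 2) k). split; [apply Rmin_glb_lt; lra|].
  intros w Hw.
  assert (W1 : Cmod (w - z) < Cmod z / 2) by (apply Rlt_le_trans with (1 := Hw); apply Rmin_l).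
  assert (W2 : Cmod (w - z) < k) by (apply Rlt_le_trans with (1 := Hw); apply Rmin_r).
  assert (Mw : Cmod z / 2 < Cmod w).
  { pose proof (Cmod_rev_triangle z w). rewrite Cmod_sub_sym in H. lra. }
  assert (Hw0 : w <> 0%C). { apply Cmod_gt_0. lra. }
  replace (/ w - / z - - / (z * z) * (w - z))%C with ((w - z) * ((w - z) / (w * z * z)))%C
    by (field; split; assumption).
  rewrite Cmod_mult, Rmult_comm. apply Rmult_le_compat_r; [apply Cmod_ge_0|].
  rewrite Cmod_div by (repeat apply Cmult_neq_0; assumption). rewrite !Cmod_mult.
  apply Rmult_le_reg_r with (Cmod w * Cmod z * Cmod z).
  { repeat apply Rmult_lt_0_compat; lra. }
  unfold Rdiv. rewrite Rmult_assoc, Rinv_l, Rmult_1_r.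
  2:{ apply Rgt_not_eq. repeat apply Rmult_lt_0_compat; lra. }
  apply Rle_trans with k; [lra|]. unfold k.
  assert (0 < Cmod z * Cmod z * eps) by (repeat apply Rmult_lt_0_compat; lra). nra.
Qed.

(** * The complex exponential *)

Definition cexp (z : C) : C := (exp (fst z) * cos (snd z), exp (fst z) * sin (snd z)).

Lemma cexp_plus (z w : C) : cexp (z + w) = (cexp z * cexp w)%C.
Proof.
  destruct z as [a b], w as [c d]. unfold cexp, Cplus, Cmult; simpl.
  rewrite exp_plus, cos_plus, sin_plus. f_equal; ring.
Qed.

Lemma cexp_0 : cexp 0 = 1%C.
Proof.
  unfold cexp; simpl. rewrite exp_0, cos_0, sin_0. unfold RtoC. f_equal; ring.
Qed.

Lemma Cmod_cexp (z : C) : Cmod (cexp z) = exp (fst z).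
Proof.
  unfold cexp, Cmod; simpl.
  transitivity (sqrt (exp (fst z) * exp (fst z))).
  - f_equal. pose proof (sin2_cos2 (snd z)). unfold Rsqr in H. nra.
  - apply sqrt_square. left. apply exp_pos.
Qed.

Lemma derive_0_bound (f : R -> R) (l eps : R) : is_derive f 0 l -> 0 < eps ->
  exists d, 0 < d /\ forall x, Rabs x < d -> Rabs (f x - f 0 - l * x) <= eps * Rabs x.
Proof.
  intros [_ H] He. destruct (H 0 (fun P HP => HP) (mkposreal eps He)) as [d Hd].
  exists d. split; [apply cond_pos|]. intros x Hx.
  assert (B : ball 0 d x). { change (Rabs (x - 0) < d). rewrite Rminus_0_r. exact Hx. }
  specialize (Hd x B).
  change (Rabs (f x - f 0 - (x - 0) * l) <= eps * Rabs (x - 0)) in Hd.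
  rewrite Rminus_0_r, Rmult_comm in Hd. exact Hd.
Qed.

Lemma Rabs_sin_le (y : R) : Rabs (sin y) <= Rabs y.
Proof.
  destruct (Rtotal_order y 0) as [Hy|[->|Hy]].
  - rewrite (Rabs_left y Hy). assert (S1 := sin_lt_x (- y) ltac:(lra)).
    assert (S2 := SIN_bound y). rewrite sin_neg in S1.
    destruct (Rle_dec (- y) 1) as [L|L].
    + assert (S3 := sin_ge_0 (- y) ltac:(lra) ltac:(pose proof PI2_1; lra)).
      rewrite sin_neg in S3. apply Rabs_le. lra.
    + apply Rabs_le. lra.
  - rewrite sin_0. lra.
  - rewrite (Rabs_pos_eq y) by lra. assert (S1 := sin_lt_x y Hy).
    assert (S2 := SIN_bound y).
    destruct (Rle_dec y 1) as [L|L].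
    + assert (S3 := sin_ge_0 y ltac:(lra) ltac:(pose proof PI2_1; lra)). apply Rabs_le. lra.
    + apply Rabs_le. lra.
Qed.

Lemma cdiff_cexp_0 : cdiff cexp 0 1.
Proof.
  (* 7 = 3 + 4, the constants of the real and imaginary errors [T1] and [T2]; the bound by 1
     controls the products of small terms. *)
  intros eps He. set (e := Rmin (eps / 7) 1).
  assert (He0 : 0 < e) by (apply Rmin_glb_lt; lra).
  assert (He1 : e <= 1) by apply Rmin_r.
  assert (He2 : 7 * e <= eps). { pose proof (Rmin_l (eps / 7) 1). fold e in H. lra. }
  clearbody e.
  destruct (derive_0_bound exp 1 e) as (d1 & P1 & B1);
    [assert (D := is_derive_exp 0); rewrite exp_0 in D; exact D|exact He0|].
  destruct (derive_0_bound sin 1 e) as (d2 & P2 & B2);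
    [assert (D := is_derive_sin 0); rewrite cos_0 in D; exact D|exact He0|].
  destruct (derive_0_bound cos (- 0) e) as (d3 & P3 & B3);
    [assert (D := is_derive_cos 0); rewrite sin_0 in D; exact D|exact He0|].
  exists (Rmin e (Rmin d1 (Rmin d2 d3))). split; [repeat apply Rmin_glb_lt; assumption|].
  intros w Hw.
  replace (w - 0)%C with w in * by ring. rewrite cexp_0.
  replace (cexp w - 1 - 1 * w)%C with (cexp w - 1 - w)%C by ring.
  pose proof (Rmin_l e (Rmin d1 (Rmin d2 d3))). pose proof (Rmin_r e (Rmin d1 (Rmin d2 d3))).
  pose proof (Rmin_l d1 (Rmin d2 d3)). pose proof (Rmin_r d1 (Rmin d2 d3)).
  pose proof (Rmin_l d2 d3). pose proof (Rmin_r d2 d3).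
  pose proof (abs_fst_le w). pose proof (abs_snd_le w).
  destruct w as [x y]. simpl fst in *. simpl snd in *.
  specialize (B1 x ltac:(lra)). specialize (B2 y ltac:(lra)). specialize (B3 y ltac:(lra)).
  rewrite exp_0, Rmult_1_l in B1. rewrite sin_0, Rmult_1_l in B2. rewrite cos_0 in B3.
  replace (cos y - 1 - - 0 * y) with (cos y - 1) in B3 by ring.
  replace (sin y - 0 - y) with (sin y - y) in B2 by ring.
  set (m := Cmod (x, y)) in *.
  assert (Rabs x < e) by lra.
  apply Rle_trans with (1 := Cmod_le_abs _). unfold cexp; simpl.
  assert (Hc : Rabs (cos y) <= 1) by (apply Rabs_le; apply COS_bound).
  assert (T1 : Rabs (exp x * cos y + - (1) + - x) <= 3 * e * m).
  { replace (exp x * cos y + - (1) + - x)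
      with ((exp x - 1 - x) * cos y + (1 + x) * (cos y - 1)) by ring.
    apply Rle_trans with (1 := Rabs_triang _ _). rewrite !Rabs_mult.
    assert (Rabs (1 + x) <= 2).
    { assert (T := Rabs_triang 1 x). rewrite Rabs_R1 in T. lra. }
    pose proof (Rabs_pos (exp x - 1 - x)). pose proof (Rabs_pos (cos y - 1)).
    pose proof (Rabs_pos x). pose proof (Rabs_pos y).
    pose proof (Rabs_pos (cos y)). nra. }
  assert (T2 : Rabs (exp x * sin y + - 0 + - y) <= 4 * e * m).
  { replace (exp x * sin y + - 0 + - y)
      with ((exp x - 1) * sin y + (sin y - y)) by ring.
    apply Rle_trans with (1 := Rabs_triang _ _). rewrite !Rabs_mult.
    assert (Rabs (exp x - 1) <= 2 * e * 1).
    { replace (exp x - 1) with ((exp x - 1 - x) + x) by ring.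
      apply Rle_trans with (1 := Rabs_triang _ _). pose proof (Rabs_pos x). nra. }
    assert (Rabs (sin y) <= Rabs y).
    { apply Rabs_sin_le. }
    pose proof (Rabs_pos (exp x - 1)). pose proof (Rabs_pos (sin y)).
    pose proof (Rabs_pos y).
    assert (Rabs (exp x - 1) * Rabs (sin y) <= 2 * e * m).
    { apply Rle_trans with (2 * e * 1 * Rabs y); [apply Rmult_le_compat; assumption|nra]. }
    nra. }
  assert (0 <= m) by apply Cmod_ge_0. nra.
Qed.

(** The functional equation transports the derivative at 0 to [z], at the price of the factor |cexp
    z| in the error. *)
Lemma cdiff_cexp (z : C) : cdiff cexp z (cexp z).
Proof.
  intros eps He.
  assert (Hz : 0 < Cmod (cexp z)) by (rewrite Cmod_cexp; apply exp_pos).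
  destruct (cdiff_cexp_0 (eps / Cmod (cexp z))) as (d & Hd & K).
  { apply Rdiv_lt_0_compat; assumption. }
  exists d. split; [exact Hd|]. intros w Hw.
  specialize (K (w - z)%C). replace (w - z - 0)%C with (w - z)%C in K by ring.
  specialize (K Hw). rewrite cexp_0 in K.
  replace (cexp w - cexp z - cexp z * (w - z))%C
    with (cexp z * (cexp (w - z) - 1 - 1 * (w - z)))%C.
  - rewrite Cmod_mult. apply (Rmult_le_compat_l (Cmod (cexp z))) in K; [|lra].
    apply Rle_trans with (1 := K). right. field. lra.
  - replace w with (z + (w - z))%C at 3 by ring. rewrite cexp_plus. ring.
Qed.

(** * Cauchy-Riemann equations and circle averages *)

Lemma cdiff_real (f : C -> C) (x y : R) (l : C) : cdiff f (x, y) l ->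
  differentiable_pt_lim (fun a b => fst (f (a, b))) x y (fst l) (- snd l) /\
  differentiable_pt_lim (fun a b => snd (f (a, b))) x y (snd l) (fst l).
Proof.
  intros H.
  assert (K : forall eps : posreal, locally_2d (fun a b =>
    Cmod (f (a, b) - f (x, y) - l * ((a, b) - (x, y))) <= eps * Rmax (Rabs (a - x)) (Rabs (b - y))) x y).
  { intros eps. destruct (H (eps / 2)) as (d & Hd & K). { apply is_pos_div_2. }
    assert (Hd2 : 0 < d / 2) by lra. exists (mkposreal _ Hd2). simpl. intros a b Ha Hb.
    assert (M : Cmod ((a, b) - (x, y)) <= Rabs (a - x) + Rabs (b - y)) by apply Cmod_le_abs.
    apply Rle_trans with (1 := K (a, b) ltac:(lra)).
    pose proof (Rmax_l (Rabs (a - x)) (Rabs (b - y))).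
    pose proof (Rmax_r (Rabs (a - x)) (Rabs (b - y))). pose proof (cond_pos eps).
    apply Rle_trans with (eps / 2 * (2 * Rmax (Rabs (a - x)) (Rabs (b - y)))); [|right; field].
    apply Rmult_le_compat_l; lra. }
  split; intros eps; destruct (K eps) as [d Hd]; exists d; intros a b Ha Hb;
    apply Rle_trans with (2 := Hd a b Ha Hb).
  - apply Rle_trans with (2 := abs_fst_le _). right. f_equal. simpl. ring.
  - apply Rle_trans with (2 := abs_snd_le _). right. f_equal. simpl. ring.
Qed.

(* In the coordinate [zeta] with [w = p + e^zeta], circles around [p] become vertical segments and
   periodicity cancels the horizontal sides of the rectangles. *)
Lemma mean_value_le (H : C -> C) (p : C) (r0 r B : R) :
  0 < r -> r < r0 ->
  (forall w, w <> p -> Cmod (w - p) < r0 -> exists l, cdiff H w l) ->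
  ccont H p ->
  (forall w, Cmod (w - p) = r -> fst (H w) <= B) ->
  fst (H p) <= B.
Proof.
  intros Hr Hr0 Hd Hc HB.
  set (f := fun z => H (p + cexp z)%C).
  assert (Df : forall x y, x < ln r0 -> exists l, cdiff f (x, y) l).
  { intros x y Hx. destruct (Hd (p + cexp (x, y))%C) as [l Hl].
    - intros E. assert (Z : cexp (x, y) = 0%C).
      { replace (cexp (x, y)) with (p + cexp (x, y) - p)%C by ring. rewrite E. ring. }
      assert (M := Cmod_cexp (x, y)). rewrite Z, Cmod_0 in M. pose proof (exp_pos x).
      simpl in M. lra.
    - replace (p + cexp (x, y) - p)%C with (cexp (x, y)) by ring. rewrite Cmod_cexp. simpl.
      rewrite <- (exp_ln r0) by lra. apply exp_increasing. exact Hx.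
    - eexists. apply (cdiff_comp H (fun z => p + cexp z)%C); [exact Hl|].
      apply cdiff_plus; [apply cdiff_const|apply cdiff_cexp]. }
  set (u := fun x y => fst (f (x, y))). set (v := fun x y => snd (f (x, y))).
  assert (CR : forall x y, x < ln r0 -> exists ux uy vx,
    differentiable_pt_lim u x y ux uy /\ differentiable_pt_lim v x y vx ux).
  { intros x y Hx. destruct (Df x y Hx) as [l Hl]. destruct (cdiff_real _ _ _ _ Hl) as [D1 D2].
    exists (fst l), (- snd l), (snd l). split; assumption. }
  assert (HPI := PI_RGT_0).
  assert (Cu : forall x y, x < ln r0 -> continuous (u x) y).
  { intros x y Hx. apply (CR_cont (ln r0) u v CR x y Hx). }
  (* Up to the factor 2 pi these are the averages of the real part of [H] over the circles of radii
     e^x and [r]. *)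
  assert (I : forall x, x < ln r -> RInt (u x) 0 (2 * PI) = RInt (u (ln r)) 0 (2 * PI)).
  { intros x Hx. apply (goursat_periodic (ln r0) u v CR).
    - lra.
    - intros t. unfold v, f, cexp; simpl. rewrite cos_0, sin_0, cos_2PI, sin_2PI. reflexivity.
    - exact Hx.
    - apply ln_increasing; assumption. }
  assert (U : RInt (u (ln r)) 0 (2 * PI) <= B * (2 * PI - 0)).
  { rewrite <- (RInt_Rconst B 0 (2 * PI)). apply RInt_le.
    - lra.
    - apply @ex_RInt_continuous. intros y _. apply Cu. apply ln_increasing; assumption.
    - apply @ex_RInt_const.
    - intros y _. apply HB. replace (p + cexp (ln r, y) - p)%C with (cexp (ln r, y)) by ring.
      rewrite Cmod_cexp. simpl. apply exp_ln. exact Hr. }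
  (* [e] is half the supposed excess of [fst (H p)] over [B]. On a circle of radius e^x below both
     [r] and [d] the average stays within [e] of [fst (H p)], hence above [B]. *)
  apply Rnot_lt_le. intros Hlt. set (e := (fst (H p) - B) / 2).
  destruct (Hc e) as (d & Pd & K). { unfold e; lra. }
  set (x := Rmin (ln r) (ln d) - 1).
  assert (X1 : x < ln r). { unfold x. pose proof (Rmin_l (ln r) (ln d)). lra. }
  assert (X2 : x < ln d). { unfold x. pose proof (Rmin_r (ln r) (ln d)). lra. }
  assert (Xr : x < ln r0). { apply Rlt_trans with (1 := X1). apply ln_increasing; assumption. }
  assert (L := RInt_near_const (u x) 0 (2 * PI) (fst (H p)) e ltac:(lra)
    ltac:(intros; apply Cu; exact Xr)).
  assert (L' : forall y, 0 <= y <= 2 * PI -> Rabs (u x y - fst (H p)) <= e).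
  { intros y _. unfold u, f.
    replace (fst (H (p + cexp (x, y))%C) - fst (H p))
      with (fst (H (p + cexp (x, y))%C - H p)%C) by (simpl; ring).
    apply Rle_trans with (1 := abs_fst_le _). left. apply K.
    replace (p + cexp (x, y) - p)%C with (cexp (x, y)) by ring. rewrite Cmod_cexp. simpl.
    rewrite <- (exp_ln d) by exact Pd. apply exp_increasing. exact X2. }
  specialize (L L'). rewrite (I x X1) in L. apply Rabs_le_between in L. unfold e in L.
  nra.
Qed.

(** * The maximum principle *)

Definition ccont_on (K : C -> Prop) (h : C -> C) : Prop :=
  forall z, K z -> forall eps, 0 < eps -> exists delta, 0 < delta /\
    forall w : C, K w -> Cmod (w - z) < delta -> Cmod (h w - h z) < eps.

Definition cclosed (K : C -> Prop) : Prop :=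
  forall z : C, (forall eps, 0 < eps -> exists w, K w /\ Cmod (w - z) < eps) -> K z.

Lemma small_inv (e : R) : 0 < e -> exists N, forall n, (N <= n)%nat -> / (INR n + 1) < e.
Proof.
  intros He. destruct (archimed_cor1 e He) as (N & HN & HN0).
  exists N. intros n Hn. apply Rle_lt_trans with (2 := HN).
  assert (0 < INR N) by (apply lt_0_INR; exact HN0).
  apply Rinv_le_contravar; [assumption|]. apply le_INR in Hn. lra.
Qed.

Lemma real_adherent (u : nat -> R) (B : R) : (forall n, Rabs (u n) <= B) ->
  exists l, forall eps N, 0 < eps -> exists n, (N <= n)%nat /\ Rabs (u n - l) < eps.
Proof.
  intros HB.
  destruct (Bolzano_Weierstrass u (fun c => - B <= c <= B) (compact_P3 (- B) B)) as [l Hl].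
  { intros n. apply Rabs_le_between, HB. }
  exists l. intros eps N He.
  destruct (Hl (disc l (mkposreal eps He)) N) as (p & Hp & Vp).
  - exists (mkposreal eps He). intros x Hx. exact Hx.
  - exists p. split; [exact Hp|exact Vp].
Qed.

(** Indices [s n] are chosen along which the real parts converge, then an adherent value of the
    imaginary parts is taken along them; [n <= s n] keeps the final index arbitrarily large. *)
Lemma complex_adherent (u : nat -> C) (B : R) : (forall n, Cmod (u n) <= B) ->
  exists l : C, forall eps N, 0 < eps -> exists n, (N <= n)%nat /\ Cmod (u n - l) < eps.
Proof.
  intros HB.
  destruct (real_adherent (fun n => fst (u n)) B) as [x Hx].
  { intros n. apply Rle_trans with (2 := HB n). apply abs_fst_le. }
  assert (Ex : forall n, exists m, (n <= m)%nat /\ Rabs (fst (u m) - x) < / (INR n + 1)).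
  { intros n. apply Hx. apply Rinv_0_lt_compat. pose proof (pos_INR n). lra. }
  set (s := fun n => proj1_sig (constructive_indefinite_description _ (Ex n))).
  assert (Hs : forall n, (n <= s n)%nat /\ Rabs (fst (u (s n)) - x) < / (INR n + 1)).
  { intros n. exact (proj2_sig (constructive_indefinite_description _ (Ex n))). }
  destruct (real_adherent (fun n => snd (u (s n))) B) as [y Hy].
  { intros n. apply Rle_trans with (2 := HB (s n)). apply abs_snd_le. }
  exists (x, y). intros eps N He.
  destruct (small_inv (eps / 2)) as [N' HN']; [lra|].
  destruct (Hy (eps / 2) (Nat.max N N') ltac:(lra)) as (n & Hn & Yn).
  exists (s n). destruct (Hs n) as [S1 S2]. split; [lia|].
  apply Rle_lt_trans with (1 := Cmod_le_abs _). simpl.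
  specialize (HN' n ltac:(lia)). unfold Rminus in S2, Yn. lra.
Qed.

(** [Adh] is sequential compactness. On a sequence with [INR n < f (u n)] it shows that [f] is
    bounded above, and on a maximizing sequence it produces the point [p]. *)
Lemma continuous_attains_max (K : C -> Prop) (f : C -> R) (B : R) :
  cclosed K -> (forall z, K z -> Cmod z <= B) -> (exists z, K z) ->
  (forall z, K z -> forall eps, 0 < eps -> exists delta, 0 < delta /\
    forall w : C, K w -> Cmod (w - z) < delta -> Rabs (f w - f z) < eps) ->
  exists p, K p /\ forall w, K w -> f w <= f p.
Proof.
  intros Kc Kb [z0 K0] Hf.
  assert (Adh : forall u : nat -> C, (forall n, K (u n)) -> exists p, K p /\
    forall eps N, 0 < eps -> exists n, (N <= n)%nat /\ Rabs (f (u n) - f p) < eps).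
  { intros u Hu. destruct (complex_adherent u B (fun n => Kb _ (Hu n))) as [p Hp].
    assert (Kp : K p).
    { apply Kc. intros eps He. destruct (Hp eps O He) as (n & _ & Hn).
      exists (u n). split; [apply Hu|exact Hn]. }
    exists p. split; [exact Kp|]. intros eps N He.
    destruct (Hf p Kp eps He) as (d & Hd & Kd).
    destruct (Hp d N Hd) as (n & Hn & Dn). exists n. split; [exact Hn|].
    apply Kd; [apply Hu|exact Dn]. }
  assert (Bd : exists S, forall w, K w -> f w <= S).
  { apply NNPP. intros N.
    assert (Ex : forall n, exists w, K w /\ INR n < f w).
    { intros n. apply NNPP. intros N'. apply N. exists (INR n). intros w Hw.
      apply Rnot_lt_le. intros L. apply N'. exists w. split; assumption. }
    set (u := fun n => proj1_sig (constructive_indefinite_description _ (Ex n))).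
    assert (Hu : forall n, K (u n) /\ INR n < f (u n)).
    { intros n. exact (proj2_sig (constructive_indefinite_description _ (Ex n))). }
    destruct (Adh u (fun n => proj1 (Hu n))) as (p & Kp & Hp).
    destruct (INR_archimed 1 (f p + 1) Rlt_0_1) as [n0 Hn0].
    destruct (Hp 1 n0 Rlt_0_1) as (n & Hn & Dn).
    destruct (Hu n) as [_ L]. apply le_INR in Hn. apply Rabs_def2 in Dn. lra. }
  destruct Bd as [S0 HS0].
  destruct (completeness (fun y => exists w, K w /\ y = f w)) as [S [HS1 HS2]].
  - exists S0. intros y (w & Kw & ->). apply HS0, Kw.
  - exists (f z0), z0. split; [exact K0|reflexivity].
  - assert (Ex : forall n, exists w, K w /\ S - / (INR n + 1) < f w).
    { intros n. apply NNPP. intros N.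
      assert (L : S <= S - / (INR n + 1)).
      { apply HS2. intros y (w & Kw & ->). apply Rnot_lt_le. intros L. apply N.
        exists w. split; assumption. }
      assert (0 < / (INR n + 1)); [|lra].
      apply Rinv_0_lt_compat. pose proof (pos_INR n). lra. }
    set (u := fun n => proj1_sig (constructive_indefinite_description _ (Ex n))).
    assert (Hu : forall n, K (u n) /\ S - / (INR n + 1) < f (u n)).
    { intros n. exact (proj2_sig (constructive_indefinite_description _ (Ex n))). }
    destruct (Adh u (fun n => proj1 (Hu n))) as (p & Kp & Hp).
    exists p. split; [exact Kp|]. intros w Kw.
    apply Rle_trans with S; [apply HS1; exists w; split; [exact Kw|reflexivity]|].
    apply Rnot_lt_le. intros L. set (e := (S - f p) / 2).
    destruct (small_inv e) as [N HN]; [unfold e; lra|].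
    destruct (Hp e N) as (n & Hn & Dn); [unfold e; lra|].
    specialize (HN n Hn). destruct (Hu n) as [_ L2]. apply Rabs_def2 in Dn.
    unfold e in *. lra.
Qed.

Lemma ccont_on_bounded (K : C -> Prop) (h : C -> C) (B : R) :
  cclosed K -> (forall z, K z -> Cmod z <= B) -> ccont_on K h ->
  exists M, 0 <= M /\ forall z, K z -> Cmod (h z) <= M.
Proof.
  intros Kc Kb Hh. destruct (classic (exists z, K z)) as [E|E].
  - destruct (continuous_attains_max K (fun z => Cmod (h z)) B Kc Kb E) as (p & Kp & Hp).
    + intros z Kz eps He. destruct (Hh z Kz eps He) as (d & Hd & D).
      exists d. split; [exact Hd|]. intros w Kw Hw. specialize (D w Kw Hw).
      pose proof (Cmod_rev_triangle (h w) (h z)). pose proof (Cmod_rev_triangle (h z) (h w)).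
      rewrite Cmod_sub_sym in H0. apply Rabs_def1; lra.
    + exists (Cmod (h p)). split; [apply Cmod_ge_0|exact Hp].
  - exists 0. split; [lra|]. intros z Kz. exfalso. apply E. exists z. exact Kz.
Qed.

(** Polarization: it trades a squared modulus for the real part of an expression linear in [b]. *)
Lemma fst_conj_mult (a b : C) :
  2 * fst (Cconj a * b)%C = Cmod a * Cmod a + Cmod b * Cmod b - Cmod (b - a) * Cmod (b - a).
Proof. rewrite !Cmod_sqr. destruct a, b. simpl. ring. Qed.

Lemma ccont_mult_const (h : C -> C) (c z : C) : ccont h z -> ccont (fun w => c * h w)%C z.
Proof.
  intros H eps He. destruct (H (eps / (Cmod c + 1))) as (d & Hd & K).
  { apply Rdiv_lt_0_compat; [exact He|]. pose proof (Cmod_ge_0 c). lra. }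
  exists d. split; [exact Hd|]. intros w Hw. specialize (K w Hw).
  replace (c * h w - c * h z)%C with (c * (h w - h z))%C by ring. rewrite Cmod_mult.
  pose proof (Cmod_ge_0 c). pose proof (Cmod_ge_0 (h w - h z)).
  apply (Rmult_lt_compat_l (Cmod c + 1)) in K; [|lra].
  replace ((Cmod c + 1) * (eps / (Cmod c + 1))) with eps in K by (field; lra). nra.
Qed.

Lemma ccont_plus (f g : C -> C) (z : C) : ccont f z -> ccont g z ->
  ccont (fun w => f w + g w)%C z.
Proof.
  intros Hf Hg eps He. destruct (Hf (eps / 2)) as (d & Hd & K); [lra|].
  destruct (Hg (eps / 2)) as (d' & Hd' & K'); [lra|].
  exists (Rmin d d'). split; [apply Rmin_glb_lt; assumption|]. intros w Hw.
  pose proof (Rmin_l d d'). pose proof (Rmin_r d d').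
  specialize (K w ltac:(lra)). specialize (K' w ltac:(lra)).
  replace (f w + g w - (f z + g z))%C with ((f w - f z) + (g w - g z))%C by ring.
  apply Rle_lt_trans with (1 := Cmod_triangle _ _). lra.
Qed.

(* The perturbation [|H|^2 + eta |z|^2] is strictly subharmonic, so that at an interior maximum the
   mean value inequality is violated without discussing where [|H|] is constant. *)
Lemma max_principle (K : C -> Prop) (H : C -> C) (M B : R) :
  cclosed K -> (forall z, K z -> Cmod z <= B) -> ccont_on K H -> 0 <= M ->
  (forall p, K p -> Cmod (H p) <= M \/ exists r, 0 < r /\
     (forall w, Cmod (w - p) < r -> K w) /\
     (forall w, w <> p -> Cmod (w - p) < r -> exists l, cdiff H w l)) ->
  forall p, K p -> Cmod (H p) <= M.
Proof.
  intros Kc Kb Hc HM Hloc p0 Kp0. apply Rnot_lt_le. intros Hlt.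
  assert (HB : 0 <= B). { apply Rle_trans with (2 := Kb _ Kp0). apply Cmod_ge_0. }
  (* Small enough that eta |z|^2 cannot make up the excess |H p0|^2 - M^2; so the maximum of [Psi]
     is not at a point where |H| <= M. *)
  set (eta := (Cmod (H p0) * Cmod (H p0) - M * M) / (2 * (B * B + 1))).
  assert (He : 0 < eta). { apply Rdiv_lt_0_compat; nra. }
  assert (He2 : eta * (B * B) < Cmod (H p0) * Cmod (H p0) - M * M).
  { apply Rlt_le_trans with (eta * (2 * (B * B + 1))); [nra|].
    right. unfold eta. field. nra. }
  set (Psi := fun z : C => Cmod (H z) * Cmod (H z) + eta * (Cmod z * Cmod z)).
  destruct (continuous_attains_max K Psi B Kc Kb (ex_intro _ p0 Kp0)) as (p & Kp & Hp).
  { intros z Kz eps Heps. set (m := Cmod (H z)). pose proof (Cmod_ge_0 (H z)). fold m in H0.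
    destruct (Hc z Kz (Rmin 1 (eps / (2 * (2 * m + 1))))) as (d & Hd & D).
    { apply Rmin_glb_lt; [lra|]. apply Rdiv_lt_0_compat; lra. }
    exists (Rmin d (eps / (2 * eta * (2 * B + 1)))).
    split. { apply Rmin_glb_lt; [exact Hd|]. apply Rdiv_lt_0_compat; nra. }
    intros w Kw Hw.
    assert (W1 := Rlt_le_trans _ _ _ Hw (Rmin_l _ _)).
    assert (W2 := Rlt_le_trans _ _ _ Hw (Rmin_r _ _)).
    specialize (D w Kw W1).
    assert (D1 := Rlt_le_trans _ _ _ D (Rmin_l _ _)).
    assert (D2 := Rlt_le_trans _ _ _ D (Rmin_r _ _)).
    pose proof (Cmod_rev_triangle (H w) (H z)) as T1.
    pose proof (Cmod_rev_triangle (H z) (H w)) as T2. rewrite Cmod_sub_sym in T2.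
    pose proof (Cmod_rev_triangle w z) as T3.
    pose proof (Cmod_rev_triangle z w) as T4. rewrite Cmod_sub_sym in T4.
    pose proof (Kb w Kw). pose proof (Kb z Kz).
    pose proof (Cmod_ge_0 (H w)). pose proof (Cmod_ge_0 w). pose proof (Cmod_ge_0 z).
    unfold Psi. fold m in T1, T2 |- *.
    set (s2 := Cmod (H w - H z)) in *. set (s := Cmod (w - z)) in *.
    assert (A1 : Rabs (Cmod (H w) * Cmod (H w) - m * m) < eps / 2).
    { replace (Cmod (H w) * Cmod (H w) - m * m)
        with ((Cmod (H w) - m) * (Cmod (H w) + m)) by ring.
      rewrite Rabs_mult. apply Rle_lt_trans with (s2 * (2 * m + 1)).
      - apply Rmult_le_compat; try apply Rabs_pos; apply Rabs_le; lra.
      - apply (Rmult_lt_compat_r (2 * m + 1)) in D2; [|lra].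
        apply Rlt_le_trans with (1 := D2). right. field. lra. }
    assert (A2 : Rabs (Cmod w * Cmod w - Cmod z * Cmod z) * eta < eps / 2).
    { replace (Cmod w * Cmod w - Cmod z * Cmod z)
        with ((Cmod w - Cmod z) * (Cmod w + Cmod z)) by ring.
      rewrite Rabs_mult. apply Rle_lt_trans with (s * (2 * B + 1) * eta).
      - apply Rmult_le_compat_r; [lra|].
        apply Rmult_le_compat; try apply Rabs_pos; apply Rabs_le; lra.
      - apply (Rmult_lt_compat_r ((2 * B + 1) * eta)) in W2; [|nra].
        rewrite Rmult_assoc.
        apply Rlt_le_trans with (1 := W2). right. field. nra. }
    replace (_ - _) with ((Cmod (H w) * Cmod (H w) - m * m) +
      (Cmod w * Cmod w - Cmod z * Cmod z) * eta) by ring.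
    apply Rle_lt_trans with (1 := Rabs_triang _ _). rewrite (Rabs_mult _ eta).
    rewrite (Rabs_pos_eq eta) by lra. lra. }
  set (c := H p) in *.
  assert (Hpp : Cmod (H p0) * Cmod (H p0) <= Cmod c * Cmod c + eta * (Cmod p * Cmod p)).
  { apply Rle_trans with (2 := Hp p0 Kp0). unfold Psi. pose proof (Cmod_ge_0 p0). nra. }
  destruct (Hloc p Kp) as [L|(r & Hr & Kr & Dr)].
  { fold c in L. pose proof (Kb p Kp). pose proof (Cmod_ge_0 p). pose proof (Cmod_ge_0 c).
    assert (Cmod p * Cmod p <= B * B) by nra. assert (Cmod c * Cmod c <= M * M) by nra. nra. }
  (* By [F1], Re F(w) = Psi(p) + Psi(w) - |H(w) - c|^2 - eta |w - p|^2. This is 2 Psi(p) at [p] and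
     at most 2 Psi(p) - eta (r/2)^2 on the circle of radius r/2, against the mean value
     inequality. *)
  set (F := fun w : C => (2 * Cconj c * H w + 2 * eta * Cconj p * w)%C).
  assert (F1 : forall w : C, fst (F w) =
    (Cmod c * Cmod c + Cmod (H w) * Cmod (H w) - Cmod (H w - c) * Cmod (H w - c)) +
    eta * (Cmod p * Cmod p + Cmod w * Cmod w - Cmod (w - p) * Cmod (w - p))).
  { intros w. rewrite <- !fst_conj_mult. unfold F. destruct c, p, (H w), w. simpl. ring. }
  assert (MV : fst (F p) <= fst (F p) - eta * ((r / 2) * (r / 2))).
  { apply (mean_value_le F p r (r / 2)); [lra|lra| | |].
    - intros w Hw Hwr. destruct (Dr w Hw Hwr) as [l Hl]. eexists.
      exact (cdiff_plus _ _ w _ _ (cdiff_mult _ _ w _ _ (cdiff_const (2 * Cconj c) w) Hl)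
        (cdiff_mult _ _ w _ _ (cdiff_const (2 * eta * Cconj p) w) (cdiff_id w))).
    - assert (Hcp : ccont H p).
      { intros eps Heps. destruct (Hc p Kp eps Heps) as (d & Hd & D).
        exists (Rmin d r). split; [apply Rmin_glb_lt; assumption|]. intros w Hw.
        pose proof (Rmin_l d r). pose proof (Rmin_r d r).
        apply D; [apply Kr|]; lra. }
      apply ccont_plus; apply ccont_mult_const; [exact Hcp|].
      exact (cdiff_cont _ _ _ (cdiff_id p)).
    - intros w Hw. assert (Kw : K w) by (apply Kr; rewrite Hw; lra).
      rewrite !F1, Hw. fold c. 
      replace (c - c)%C with (RtoC 0) by ring.
      replace (p - p)%C with (RtoC 0) by ring. rewrite Cmod_0.
      assert (PW := Hp w Kw). unfold Psi in PW. fold c in PW.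
      pose proof (Cmod_ge_0 (H w - c)). nra. }
  assert (0 < eta * (r / 2 * (r / 2))) by (apply Rmult_lt_0_compat; nra). lra.
Qed.

Definition cdisc (p : C) (R : R) (z : C) : Prop := Cmod (z - p) <= R.

Lemma cdisc_closed (p : C) (R : R) : cclosed (cdisc p R).
Proof.
  intros z Hz. apply Rnot_lt_le. intros L.
  destruct (Hz (Cmod (z - p) - R)) as (w & Kw & Hw); [lra|]. unfold cdisc in Kw.
  pose proof (Cmod_sub_triangle z w p). rewrite Cmod_sub_sym in Hw. lra.
Qed.

Lemma cdisc_bounded (p : C) (R : R) (z : C) : cdisc p R z -> Cmod z <= R + Cmod p.
Proof. intros H. pose proof (Cmod_rev_triangle z p). unfold cdisc in H. lra. Qed.

(** The centre is exempt from differentiability so that [H] may be a difference quotient completed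
    at [p] by its limit. *)
Lemma disc_max_principle (H : C -> C) (p : C) (R M : R) :
  0 < R -> ccont_on (cdisc p R) H -> 0 <= M ->
  (forall w, w <> p -> Cmod (w - p) < R -> exists l, cdiff H w l) ->
  (forall w, Cmod (w - p) = R -> Cmod (H w) <= M) ->
  forall w, cdisc p R w -> Cmod (H w) <= M.
Proof.
  intros HR Hc HM Hd Hb.
  apply (max_principle (cdisc p R) H M (R + Cmod p)); try assumption.
  - apply cdisc_closed.
  - apply cdisc_bounded.
  - intros q Hq. unfold cdisc in Hq. destruct (Req_dec (Cmod (q - p)) R) as [E|E].
    { left. apply Hb, E. }
    right. destruct (classic (q = p)) as [->|Hqp].
    + exists R. split; [exact HR|]. split; [intros w Hw; left; exact Hw|exact Hd].
    + assert (0 < Cmod (q - p)).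
      { apply Cmod_gt_0. intros E2. apply Hqp. replace q with (q - p + p)%C by ring.
        rewrite E2. ring. }
      (* The disc around [q] has to avoid the exceptional centre as well as stay inside the large
         disc. *)
      exists (Rmin (Cmod (q - p)) (R - Cmod (q - p))).
      split; [apply Rmin_glb_lt; lra|].
      pose proof (Rmin_l (Cmod (q - p)) (R - Cmod (q - p))).
      pose proof (Rmin_r (Cmod (q - p)) (R - Cmod (q - p))).
      assert (T : forall w, Cmod (w - q) < Rmin (Cmod (q - p)) (R - Cmod (q - p)) ->
        Cmod (w - p) < R /\ w <> p).
      { intros w Hw. pose proof (Cmod_sub_triangle w q p). split; [lra|].
        intros ->. rewrite Cmod_sub_sym in Hw. lra. }
      split; [intros w Hw; left; apply T, Hw|].
      intros w _ Hw. apply Hd; apply T, Hw.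
Qed.

(** * Difference quotients, zeros and uniform limits *)

Lemma ccont_ccont_on (K : C -> Prop) (f : C -> C) :
  (forall z, K z -> ccont f z) -> ccont_on K f.
Proof.
  intros H z Kz eps He. destruct (H z Kz eps He) as (d & Hd & D).
  exists d. split; [exact Hd|]. intros w _. apply D.
Qed.

Lemma ccont_on_sub (K K' : C -> Prop) (f : C -> C) :
  (forall z, K' z -> K z) -> ccont_on K f -> ccont_on K' f.
Proof.
  intros S H z Kz eps He. destruct (H z (S z Kz) eps He) as (d & Hd & D).
  exists d. split; [exact Hd|]. intros w Kw. apply D, S, Kw.
Qed.

Lemma ccont_on_minus (K : C -> Prop) (f g : C -> C) :
  ccont_on K f -> ccont_on K g -> ccont_on K (fun w => f w - g w)%C.
Proof.
  intros Hf Hg z Kz eps He. destruct (Hf z Kz (eps / 2)) as (d & Hd & D); [lra|].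
  destruct (Hg z Kz (eps / 2)) as (d' & Hd' & D'); [lra|].
  exists (Rmin d d'). split; [apply Rmin_glb_lt; assumption|]. intros w Kw Hw.
  pose proof (Rmin_l d d'). pose proof (Rmin_r d d').
  specialize (D w Kw ltac:(lra)). specialize (D' w Kw ltac:(lra)).
  rewrite Cmod_sub_sym in D'.
  replace (f w - g w - (f z - g z))%C with ((f w - f z) + (g z - g w))%C by ring.
  apply Rle_lt_trans with (1 := Cmod_triangle _ _). lra.
Qed.

Lemma ccont_on_mult (K : C -> Prop) (f g : C -> C) :
  ccont_on K f -> ccont_on K g -> ccont_on K (fun w => f w * g w)%C.
Proof.
  intros Hf Hg z Kz eps He.
  set (a := Cmod (f z)). set (b := Cmod (g z)).
  assert (Ha : 0 <= a) by apply Cmod_ge_0. assert (Hb : 0 <= b) by apply Cmod_ge_0.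
  destruct (Hf z Kz (Rmin 1 (eps / (2 * (b + 1))))) as (d & Hd & D).
  { apply Rmin_glb_lt; [lra|]. apply Rdiv_lt_0_compat; lra. }
  destruct (Hg z Kz (eps / (2 * (a + 1)))) as (d' & Hd' & D').
  { apply Rdiv_lt_0_compat; lra. }
  exists (Rmin d d'). split; [apply Rmin_glb_lt; assumption|]. intros w Kw Hw.
  pose proof (Rmin_l d d'). pose proof (Rmin_r d d').
  specialize (D w Kw ltac:(lra)). specialize (D' w Kw ltac:(lra)).
  assert (D1 := Rlt_le_trans _ _ _ D (Rmin_l _ _)).
  assert (D2 := Rlt_le_trans _ _ _ D (Rmin_r _ _)).
  replace (f w * g w - f z * g z)%C
    with ((f w - f z) * g z + (f z + (f w - f z)) * (g w - g z))%C by ring.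
  apply Rle_lt_trans with (1 := Cmod_triangle _ _). rewrite !Cmod_mult.
  pose proof (Cmod_triangle (f z) (f w - f z)). fold a in H1. fold b.
  pose proof (Cmod_ge_0 (f z + (f w - f z))).
  set (p := Cmod (f w - f z)) in *. set (q := Cmod (g w - g z)) in *.
  assert (0 <= p) by apply Cmod_ge_0. assert (0 <= q) by apply Cmod_ge_0.
  apply (Rmult_lt_compat_r (b + 1)) in D2; [|lra].
  replace (eps / (2 * (b + 1)) * (b + 1)) with (eps / 2) in D2 by (field; lra).
  apply (Rmult_lt_compat_r (a + 1)) in D'; [|lra].
  replace (eps / (2 * (a + 1)) * (a + 1)) with (eps / 2) in D' by (field; lra).
  nra.
Qed.

Lemma cdiff_minus (f g : C -> C) (z lf lg : C) :
  cdiff f z lf -> cdiff g z lg -> cdiff (fun w => f w - g w)%C z (lf - lg)%C.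
Proof.
  intros Hf Hg. apply cdiff_is_derive in Hf, Hg. apply cdiff_is_derive.
  exact (is_derive_minus (V := AbsRing_NormedModule C_AbsRing) _ _ _ _ _ Hf Hg).
Qed.

Lemma Csub_neq_0 (z p : C) : z <> p -> (z - p)%C <> 0%C.
Proof. intros H E. apply H. replace z with (z - p + p)%C by ring. rewrite E. ring. Qed.

Lemma Cmod_sub_pos (z p : C) : z <> p -> 0 < Cmod (z - p).
Proof. intros H. apply Cmod_gt_0, Csub_neq_0, H. Qed.

Lemma Cmod_diag (z : C) : Cmod (z - z) = 0.
Proof. replace (z - z)%C with (RtoC 0) by ring. apply Cmod_0. Qed.

(** Meant for [h p = 0]: the difference quotient of [h] at [p], completed there by the derivative
    [l]. *)
Definition slope (h : C -> C) (p l w : C) : C :=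
  if excluded_middle_informative (w = p) then l else (h w / (w - p))%C.

Lemma slope_p (h : C -> C) (p l : C) : slope h p l p = l.
Proof. unfold slope. destruct excluded_middle_informative; [reflexivity|congruence]. Qed.

Lemma slope_neq (h : C -> C) (p l w : C) : w <> p -> slope h p l w = (h w / (w - p))%C.
Proof. intros H. unfold slope. destruct excluded_middle_informative; [congruence|reflexivity]. Qed.

Lemma slope_mod (h : C -> C) (p l w : C) : h p = 0%C -> Cmod (h w) = Cmod (slope h p l w) * Cmod (w - p).
Proof.
  intros H0. destruct (classic (w = p)) as [->|N].
  - rewrite H0, Cmod_diag, Cmod_0. ring.
  - rewrite slope_neq by exact N. rewrite Cmod_div by (apply Csub_neq_0; exact N).
    field. apply Rgt_not_eq, Cmod_sub_pos, N.
Qed.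

Lemma slope_cdiff (h : C -> C) (p l w : C) : w <> p -> (exists m, cdiff h w m) ->
  exists m, cdiff (slope h p l) w m.
Proof.
  intros N [m Hm].
  assert (Di := cdiff_comp Cinv (fun z => z - p)%C w _ _ (cdiff_inv _ (Csub_neq_0 _ _ N))
    (cdiff_minus _ _ w _ _ (cdiff_id w) (cdiff_const p w))).
  eexists. apply (cdiff_ext (fun z => h z * / (z - p))%C _ w _ (Cmod (w - p))).
  - apply Cmod_sub_pos, N.
  - intros z Hz. rewrite slope_neq; [reflexivity|]. intros ->.
    rewrite Cmod_sub_sym in Hz. lra.
  - exact (cdiff_mult _ _ w _ _ Hm Di).
Qed.

(** At [p] this is the definition of the derivative; elsewhere the slope agrees with a continuous
    quotient on a neighbourhood that avoids [p]. *)
Lemma slope_cont (K : C -> Prop) (h : C -> C) (p l : C) : ccont_on K h -> h p = 0%C -> cdiff h p l ->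
  ccont_on K (slope h p l).
Proof.
  intros Hc H0 Hl z Kz eps He. destruct (classic (z = p)) as [->|N].
  - destruct (Hl (eps / 2)) as (d & Hd & D); [lra|]. exists d. split; [exact Hd|].
    intros w _ Hw. rewrite slope_p. destruct (classic (w = p)) as [->|Nw].
    { rewrite slope_p, Cmod_diag. exact He. }
    rewrite slope_neq by exact Nw. specialize (D w Hw). rewrite H0 in D.
    assert (P := Cmod_sub_pos _ _ Nw).
    replace (h w / (w - p) - l)%C with ((h w - 0 - l * (w - p)) / (w - p))%C
      by (field; apply Csub_neq_0; exact Nw).
    rewrite Cmod_div by (apply Csub_neq_0; exact Nw).
    apply Rmult_lt_reg_r with (Cmod (w - p)); [exact P|].
    unfold Rdiv. rewrite Rmult_assoc, Rinv_l, Rmult_1_r by lra. nra.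
  - assert (Ci : ccont (fun w => / (w - p))%C z).
    { apply (cdiff_cont _ _ _ (cdiff_comp Cinv (fun z => z - p)%C z _ _
        (cdiff_inv _ (Csub_neq_0 _ _ N))
        (cdiff_minus _ _ z _ _ (cdiff_id z) (cdiff_const p z)))). }
    assert (Cq : ccont_on (fun w => K w /\ w <> p) (fun w => h w * / (w - p))%C).
    { apply ccont_on_mult.
      - apply ccont_on_sub with (2 := Hc). tauto.
      - apply ccont_ccont_on. intros w [_ Nw].
        apply (cdiff_cont _ _ _ (cdiff_comp Cinv (fun z => z - p)%C w _ _
          (cdiff_inv _ (Csub_neq_0 _ _ Nw))
          (cdiff_minus _ _ w _ _ (cdiff_id w) (cdiff_const p w)))). }
    destruct (Cq z (conj Kz N) eps He) as (d & Hd & D).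
    exists (Rmin d (Cmod (z - p))). split; [apply Rmin_glb_lt; [exact Hd|apply Cmod_sub_pos, N]|].
    intros w Kw Hw. pose proof (Rmin_l d (Cmod (z - p))). pose proof (Rmin_r d (Cmod (z - p))).
    assert (Nw : w <> p). { intros ->. rewrite Cmod_sub_sym in Hw. lra. }
    rewrite !slope_neq by assumption. apply D; [split; assumption|lra].
Qed.

(** The argument of Schwarz's lemma: on the circle the slope is at most M / R, and the maximum
    principle carries this inside. *)
Lemma slope_bound (h : C -> C) (p l : C) (R M : R) : 0 < R -> 0 <= M ->
  ccont_on (cdisc p R) h ->
  (forall w, w <> p -> Cmod (w - p) < R -> exists m, cdiff h w m) ->
  h p = 0%C -> cdiff h p l ->
  (forall w, Cmod (w - p) = R -> Cmod (h w) <= M) ->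
  forall w, cdisc p R w -> Cmod (slope h p l w) <= M / R.
Proof.
  intros HR HM Hc Hd H0 Hl HB. apply disc_max_principle.
  - exact HR.
  - apply slope_cont; assumption.
  - apply Rdiv_le_0_compat; lra.
  - intros w N Hw. apply slope_cdiff; [exact N|]. apply Hd; assumption.
  - intros w Hw. assert (N : w <> p). { intros ->. rewrite Cmod_diag in Hw. lra. }
    rewrite slope_neq by exact N. rewrite Cmod_div by (apply Csub_neq_0; exact N).
    rewrite Hw. apply Rmult_le_compat_r; [left; apply Rinv_0_lt_compat, HR|apply HB, Hw].
Qed.

(** Schwarz's argument applied to g - g(p), which is bounded by 2e. It stands in for Cauchy's
    estimate of the derivative. *)
Lemma holo_lipschitz_center (g : C -> C) (p l : C) (R e : R) : 0 < R ->
  ccont_on (cdisc p R) g ->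
  (forall w, Cmod (w - p) < R -> exists m, cdiff g w m) ->
  (forall w, cdisc p R w -> Cmod (g w) <= e) -> cdiff g p l ->
  Cmod l <= 2 * e / R /\
  forall w, cdisc p R w -> Cmod (g w - g p) <= 2 * e / R * Cmod (w - p).
Proof.
  intros HR Hc Hd Hb Hl.
  assert (Kp : cdisc p R p) by (unfold cdisc; rewrite Cmod_diag; lra).
  assert (He : 0 <= e) by (apply Rle_trans with (2 := Hb p Kp); apply Cmod_ge_0).
  set (h := fun w => (g w - g p)%C).
  assert (H0 : h p = 0%C) by (unfold h; ring).
  assert (Dh : forall w m, cdiff g w m -> cdiff h w m).
  { intros w m Hm. replace m with (m - 0)%C by ring.
    exact (cdiff_minus _ _ w _ _ Hm (cdiff_const (g p) w)). }
  assert (S : forall w, cdisc p R w -> Cmod (slope h p l w) <= 2 * e / R).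
  { apply slope_bound; try assumption; [lra| | | |].
    - apply ccont_on_minus; [exact Hc|]. apply ccont_ccont_on. intros z _.
      exact (cdiff_cont _ _ _ (cdiff_const (g p) z)).
    - intros w _ Hw. destruct (Hd w Hw) as [m Hm]. exists m. apply Dh, Hm.
    - apply Dh, Hl.
    - intros w Hw. unfold h. assert (Kw : cdisc p R w) by (right; exact Hw).
      apply Rle_trans with (1 := Cmod_triangle _ _). rewrite Cmod_opp.
      pose proof (Hb w Kw). pose proof (Hb p Kp). lra. }
  split.
  - rewrite <- (slope_p h p l). apply S, Kp.
  - intros w Kw. change (g w - g p)%C with (h w). rewrite (slope_mod h p l) by exact H0.
    apply Rmult_le_compat_r; [apply Cmod_ge_0|apply S, Kw].
Qed.

Lemma cdiff_zero (h : C -> C) (p : C) (r : R) : 0 < r ->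
  (forall w, Cmod (w - p) < r -> h w = 0%C) -> cdiff h p 0.
Proof.
  intros Hr Hz. apply (cdiff_ext (fun _ => 0%C) h p 0 r Hr).
  - intros w Hw. symmetry. apply Hz, Hw.
  - apply cdiff_const.
Qed.

(** The slope of a function vanishing near [p] again vanishes near [p], so one may divide by w - p
    any number of times, each division gaining a factor |w - p| / R. *)
Lemma zero_disc_decay (p : C) (R r : R) (n : nat) : 0 < R -> 0 < r ->
  forall (h : C -> C) M, 0 <= M ->
  ccont_on (cdisc p R) h ->
  (forall w, w <> p -> Cmod (w - p) < R -> exists m, cdiff h w m) ->
  (forall w, Cmod (w - p) < r -> h w = 0%C) ->
  (forall w, cdisc p R w -> Cmod (h w) <= M) ->
  forall w, cdisc p R w -> Cmod (h w) <= M * (Cmod (w - p) / R) ^ n.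
Proof.
  intros HR Hr. induction n as [|n IH]; intros h M HM Hc Hd Hz HB w Kw.
  { rewrite pow_O, Rmult_1_r. apply HB, Kw. }
  assert (H0 : h p = 0%C) by (apply Hz; rewrite Cmod_diag; exact Hr).
  assert (Dp := cdiff_zero h p r Hr Hz).
  rewrite (slope_mod h p 0) by exact H0.
  assert (I : Cmod (slope h p 0 w) <= M / R * (Cmod (w - p) / R) ^ n).
  { apply IH.
    - apply Rdiv_le_0_compat; lra.
    - apply slope_cont; assumption.
    - intros z N Hz'. apply slope_cdiff; [exact N|]. apply Hd; assumption.
    - intros z Hzr. destruct (classic (z = p)) as [->|N]; [apply slope_p|].
      rewrite slope_neq by exact N. rewrite Hz by exact Hzr. unfold Cdiv. ring.
    - apply slope_bound; try assumption. intros z Hz'. apply HB. right; exact Hz'.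
    - exact Kw. }
  apply (Rmult_le_compat_r (Cmod (w - p))) in I; [|apply Cmod_ge_0].
  apply Rle_trans with (1 := I). right. simpl. field. lra.
Qed.

Lemma zero_on_disc (h : C -> C) (p : C) (R r : R) : 0 < R -> 0 < r ->
  ccont_on (cdisc p R) h ->
  (forall w, Cmod (w - p) < R -> exists m, cdiff h w m) ->
  (forall w, Cmod (w - p) < r -> h w = 0%C) ->
  forall w, Cmod (w - p) < R -> h w = 0%C.
Proof.
  intros HR Hr Hc Hd Hz w Hw.
  destruct (ccont_on_bounded _ h _ (cdisc_closed p R) (cdisc_bounded p R) Hc) as (M & HM & HB).
  assert (D := fun n => zero_disc_decay p R r n HR Hr h M HM Hc (fun w _ => Hd w) Hz HB w (Rlt_le _ _ Hw)).
  apply Cmod_eq_0. apply Rle_antisym; [|apply Cmod_ge_0].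
  apply Rnot_lt_le. intros L.
  set (q := Cmod (w - p) / R) in *.
  assert (Hq : 0 <= q < 1).
  { unfold q. split; [apply Rdiv_le_0_compat; [apply Cmod_ge_0|exact HR]|].
    apply Rmult_lt_reg_r with R; [exact HR|]. unfold Rdiv. rewrite Rmult_assoc, Rinv_l; lra. }
  destruct (pow_lt_1_zero q ltac:(rewrite Rabs_pos_eq; lra) (Cmod (h w) / (M + 1))) as [n Hn].
  { apply Rdiv_lt_0_compat; lra. }
  specialize (Hn n (le_n n)). specialize (D n).
  assert (0 <= q ^ n) by (apply pow_le; lra). rewrite Rabs_pos_eq in Hn by assumption.
  apply (Rmult_lt_compat_r (M + 1)) in Hn; [|lra].
  replace (Cmod (h w) / (M + 1) * (M + 1)) with (Cmod (h w)) in Hn by (field; lra). nra.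
Qed.

(** * Uniform limits of holomorphic functions *)

Lemma uniform_limit (K : C -> Prop) (h : nat -> C -> C) :
  (forall eps, 0 < eps -> exists N, forall n m z, (N <= n)%nat -> (N <= m)%nat -> K z ->
     Cmod (h n z - h m z) <= eps) ->
  exists g : C -> C, forall eps, 0 < eps -> exists N, forall n z, (N <= n)%nat -> K z ->
     Cmod (h n z - g z) <= eps.
Proof.
  intros HC.
  assert (Ex : forall z, exists l : C, K z -> Un_cv (fun n => fst (h n z)) (fst l) /\
    Un_cv (fun n => snd (h n z)) (snd l)).
  { intros z. destruct (classic (K z)) as [Kz|Nz]; [|exists 0%C; tauto].
    destruct (Rcomplete.R_complete (fun n => fst (h n z))) as [x Hx].
    { intros eps He. destruct (HC (eps / 2)) as [N HN]; [lra|]. exists N. intros n m Hn Hm.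
      apply Rle_lt_trans with (eps / 2); [|lra].
      apply Rle_trans with (2 := HN n m z Hn Hm Kz). exact (abs_fst_le (h n z - h m z)). }
    destruct (Rcomplete.R_complete (fun n => snd (h n z))) as [y Hy].
    { intros eps He. destruct (HC (eps / 2)) as [N HN]; [lra|]. exists N. intros n m Hn Hm.
      apply Rle_lt_trans with (eps / 2); [|lra].
      apply Rle_trans with (2 := HN n m z Hn Hm Kz). exact (abs_snd_le (h n z - h m z)). }
    exists (x, y). intros _. split; assumption. }
  set (g := fun z => proj1_sig (constructive_indefinite_description _ (Ex z))).
  assert (Hg : forall z, K z -> Un_cv (fun n => fst (h n z)) (fst (g z)) /\
    Un_cv (fun n => snd (h n z)) (snd (g z))).
  { intros z. exact (proj2_sig (constructive_indefinite_description _ (Ex z))). }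
  exists g. intros eps He. destruct (HC eps He) as [N HN]. exists N. intros n z Hn Kz.
  apply le_epsilon. intros e Hpe. destruct (Hg z Kz) as [G1 G2].
  destruct (G1 (e / 2)) as [N1 H1]; [lra|]. destruct (G2 (e / 2)) as [N2 H2]; [lra|].
  set (m := Nat.max N (Nat.max N1 N2)).
  specialize (H1 m ltac:(lia)). specialize (H2 m ltac:(lia)).
  specialize (HN n m z Hn ltac:(lia) Kz).
  apply Rle_trans with (1 := Cmod_sub_triangle _ (h m z) _).
  assert (Cmod (h m z - g z) <= e); [|lra].
  apply Rle_trans with (1 := Cmod_le_abs _). unfold Rdist, Rminus in H1, H2. simpl. lra.
Qed.

Definition cuniform (K : C -> Prop) (h : nat -> C -> C) (g : C -> C) : Prop :=
  forall eps, 0 < eps -> exists N, forall n z, (N <= n)%nat -> K z ->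
     Cmod (h n z - g z) <= eps.

Lemma uniform_limit_cont (K : C -> Prop) (h : nat -> C -> C) (g : C -> C) :
  (forall n, ccont_on K (h n)) -> cuniform K h g -> ccont_on K g.
Proof.
  intros Hc Hu z Kz eps He. destruct (Hu (eps / 4)) as [N HN]; [lra|].
  destruct (Hc N z Kz (eps / 4)) as (d & Hd & D); [lra|].
  exists d. split; [exact Hd|]. intros w Kw Hw. specialize (D w Kw Hw).
  assert (E1 := HN N z (le_n N) Kz). assert (E2 := HN N w (le_n N) Kw).
  rewrite Cmod_sub_sym in E2.
  replace (g w - g z)%C with ((g w - h N w) + (h N w - h N z) + (h N z - g z))%C by ring.
  apply Rle_lt_trans with (1 := Cmod_triangle _ _).
  pose proof (Cmod_triangle (g w - h N w) (h N w - h N z)). lra.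
Qed.

Lemma complex_complete (l : nat -> C) :
  (forall eps, 0 < eps -> exists N, forall n m, (N <= n)%nat -> (N <= m)%nat ->
     Cmod (l n - l m) <= eps) ->
  exists x : C, forall eps, 0 < eps -> exists N, forall n, (N <= n)%nat -> Cmod (l n - x) <= eps.
Proof.
  intros H. destruct (uniform_limit (fun _ => True) (fun n _ => l n)) as [g Hg].
  - intros eps He. destruct (H eps He) as [N HN]. exists N. intros n m _ Hn Hm _. apply HN; assumption.
  - exists (g 0%C). intros eps He. destruct (Hg eps He) as [N HN]. exists N. intros n Hn.
    exact (HN n 0%C Hn I).
Qed.

(* A Weierstrass theorem without Cauchy's integral: by the maximum principle for difference
   quotients, uniform closeness on a disc controls the difference quotients at its centre. *)
Lemma uniform_limit_holo (p : C) (R : R) (h : nat -> C -> C) (g : C -> C) : 0 < R ->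
  (forall n, ccont_on (cdisc p R) (h n)) ->
  (forall n w, Cmod (w - p) < R -> exists m, cdiff (h n) w m) ->
  cuniform (cdisc p R) h g -> exists l, cdiff g p l.
Proof.
  intros HR Hc Hd Hu.
  assert (Ex : forall n, exists l, cdiff (h n) p l).
  { intros n. apply Hd. rewrite Cmod_diag. exact HR. }
  set (l := fun n => proj1_sig (constructive_indefinite_description _ (Ex n))).
  assert (Hl : forall n, cdiff (h n) p (l n)).
  { intros n. exact (proj2_sig (constructive_indefinite_description _ (Ex n))). }
  assert (Q : forall eps, 0 < eps -> exists N, forall n m, (N <= n)%nat -> (N <= m)%nat ->
    Cmod (l n - l m) <= eps /\ forall w, cdisc p R w ->
    Cmod ((h n w - h m w) - (h n p - h m p)) <= eps * Cmod (w - p)).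
  (* Two functions within eps R / 4 of [g] differ by at most e = eps R / 2, for which the Lipschitz
     constant 2 e / R is [eps]. *)
  { intros eps He. assert (He' : 0 < eps * R / 4) by (apply Rdiv_lt_0_compat; nra).
    destruct (Hu _ He') as [N HN]. exists N. intros n m Hn Hm.
    destruct (holo_lipschitz_center (fun w => h n w - h m w)%C p (l n - l m)%C R (eps * R / 2) HR)
      as [L1 L2].
    - apply ccont_on_minus; apply Hc.
    - intros w Hw. destruct (Hd n w Hw) as [a Ha]. destruct (Hd m w Hw) as [b Hb].
      exists (a - b)%C. apply cdiff_minus; assumption.
    - intros w Kw. assert (E1 := HN n w Hn Kw). assert (E2 := HN m w Hm Kw).
      rewrite Cmod_sub_sym in E2. apply Rle_trans with (1 := Cmod_sub_triangle _ (g w) _). lra.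
    - apply cdiff_minus; apply Hl.
    - replace (2 * (eps * R / 2) / R) with eps in L1, L2 by (field; lra). split; assumption. }
  destruct (complex_complete l) as [x Hx].
  { intros eps He. destruct (Q eps He) as [N HN]. exists N. intros n m Hn Hm. apply HN; assumption. }
  exists x. intros eps He.
  destruct (Q (eps / 3)) as [N1 H1]; [lra|]. destruct (Hx (eps / 3)) as [N2 H2]; [lra|].
  set (n := Nat.max N1 N2). destruct (Hl n (eps / 3)) as (d & Pd & D); [lra|].
  exists (Rmin d R). split; [apply Rmin_glb_lt; assumption|]. intros w Hw.
  pose proof (Rmin_l d R). pose proof (Rmin_r d R).
  assert (Kw : cdisc p R w) by (unfold cdisc; lra).
  assert (Kp : cdisc p R p) by (unfold cdisc; rewrite Cmod_diag; lra).
  (* This is [Q] with m tending to infinity; the arbitrary [e] absorbs the replacement of [h m] by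
     [g]. *)
  assert (A : Cmod ((h n w - g w) - (h n p - g p)) <= eps / 3 * Cmod (w - p)).
  { apply le_epsilon. intros e Hpe. destruct (Hu (e / 2)) as [N3 H3]; [lra|].
    set (m := Nat.max N1 N3). destruct (H1 n m ltac:(lia) ltac:(lia)) as [_ B].
    specialize (B w Kw). assert (E1 := H3 m w ltac:(lia) Kw). assert (E2 := H3 m p ltac:(lia) Kp).
    rewrite Cmod_sub_sym in E2.
    replace (h n w - g w - (h n p - g p))%C
      with ((h n w - h m w - (h n p - h m p)) + ((h m w - g w) + (g p - h m p)))%C by ring.
    apply Rle_trans with (1 := Cmod_triangle _ _).
    pose proof (Cmod_triangle (h m w - g w) (g p - h m p)). lra. }
  specialize (D w ltac:(lra)). specialize (H2 n ltac:(lia)).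
  replace (g w - g p - x * (w - p))%C with
    (- ((h n w - g w) - (h n p - g p)) + ((h n w - h n p - l n * (w - p)) + (l n - x) * (w - p)))%C
    by ring.
  apply Rle_trans with (1 := Cmod_triangle _ _). rewrite Cmod_opp.
  pose proof (Cmod_triangle (h n w - h n p - l n * (w - p)) ((l n - x) * (w - p))) as T.
  rewrite (Cmod_mult (l n - x)) in T.
  apply (Rmult_le_compat_r (Cmod (w - p))) in H2; [|apply Cmod_ge_0]. lra.
Qed.

(** * Circular segments *)

Definition dot (z a : C) : R := fst z * fst a + snd z * snd a.

Lemma dot_le (z a : C) : Cmod a = 1 -> Rabs (dot z a) <= Cmod z.
Proof.
  intros Ha. replace (dot z a) with (fst (z * Cconj a)%C).
  - apply Rle_trans with (1 := abs_fst_le _). rewrite Cmod_mult, Cmod_conj, Ha. lra.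
  - destruct z, a. unfold dot. simpl. ring.
Qed.

Lemma dot_lipschitz (z w a : C) : Cmod a = 1 -> Rabs (dot z a - dot w a) <= Cmod (z - w).
Proof.
  intros Ha. replace (dot z a - dot w a) with (dot (z - w)%C a).
  - apply dot_le, Ha.
  - destruct z, w, a. unfold dot. simpl. ring.
Qed.

Lemma dot_self (a : C) : Cmod a = 1 -> dot a a = 1.
Proof. intros Ha. unfold dot. rewrite <- Cmod_sqr, Ha. ring. Qed.

Lemma dot_dist (z a : C) : Cmod a = 1 ->
  Cmod (z - a) * Cmod (z - a) = Cmod z * Cmod z + 1 - 2 * dot z a.
Proof.
  intros Ha. replace 1 with (Cmod a * Cmod a) by (rewrite Ha; ring).
  rewrite !Cmod_sqr. destruct z, a. unfold dot. simpl. ring.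
Qed.

Definition cap (a : C) (d : R) (z : C) : Prop := Cmod z <= 1 /\ 1 - d <= dot z a.
Definition capint (a : C) (d : R) (z : C) : Prop := Cmod z < 1 /\ 1 - d < dot z a.

Lemma capint_cap (a : C) (d : R) (z : C) : capint a d z -> cap a d z.
Proof. unfold cap, capint. lra. Qed.

Lemma cap_closed (a : C) (d : R) : Cmod a = 1 -> cclosed (cap a d).
Proof.
  intros Ha z Hz. split; apply le_epsilon; intros e He.
  - destruct (Hz e He) as (w & [K _] & Hw). rewrite Cmod_sub_sym in Hw.
    pose proof (Cmod_rev_triangle z w). lra.
  - destruct (Hz e He) as (w & [_ K] & Hw).
    pose proof (dot_lipschitz w z a Ha) as L. apply Rabs_le_between in L. lra.
Qed.

Lemma cap_bounded (a : C) (d : R) (z : C) : cap a d z -> Cmod z <= 1.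
Proof. intros H. apply H. Qed.

Lemma capint_open (a : C) (d : R) (p : C) : Cmod a = 1 -> capint a d p ->
  exists r, 0 < r /\ forall w, Cmod (w - p) <= r -> capint a d w.
Proof.
  intros Ha [H1 H2]. set (s := Rmin (1 - Cmod p) (dot p a - (1 - d))).
  assert (Hs : 0 < s) by (apply Rmin_glb_lt; lra).
  assert (S1 : s <= 1 - Cmod p) by apply Rmin_l.
  assert (S2 : s <= dot p a - (1 - d)) by apply Rmin_r.
  exists (s / 2). split; [lra|]. intros w Hw.
  pose proof (Cmod_rev_triangle w p).
  pose proof (dot_lipschitz w p a Ha) as L. apply Rabs_le_between in L. split; lra.
Qed.

(** The weight is exp(lam (1 - d)) on the chord, where only the bound [M] is available, and at most
    exp(lam) on the arc, where [e] is. Dividing by the weight at [w] gives the two terms. [lam]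
    stays free: a large value kills the first term, and the second is repaired by a small [e]. *)
Lemma two_constants (a : C) (d M e lam : R) (h : C -> C) :
  Cmod a = 1 -> 0 <= lam -> 0 <= M -> 0 <= e -> ccont_on (cap a d) h ->
  (forall w, capint a d w -> exists l, cdiff h w l) ->
  (forall w, cap a d w -> Cmod (h w) <= M) ->
  (forall w, cap a d w -> Cmod w = 1 -> Cmod (h w) <= e) ->
  forall w, cap a d w ->
    Cmod (h w) <= Rmax (M * exp (- (lam * (dot w a - (1 - d))))) (e * exp (lam * (1 - dot w a))).
Proof.
  intros Ha Hlam HM He Hc Hd HhM Hhe.
  set (W := fun z => cexp (lam * Cconj a * z)%C).
  assert (WM : forall z, Cmod (W z) = exp (lam * dot z a)).
  { intros z. unfold W. rewrite Cmod_cexp. f_equal. destruct z, a. unfold dot. simpl. ring. }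
  assert (WD : forall z, exists l, cdiff W z l).
  { intros z. eexists. apply (cdiff_comp cexp (fun z => lam * Cconj a * z)%C).
    - apply cdiff_cexp.
    - exact (cdiff_mult _ _ z _ _ (cdiff_const (lam * Cconj a) z) (cdiff_id z)). }
  set (M' := Rmax (M * exp (lam * (1 - d))) (e * exp lam)).
  assert (G : forall w, cap a d w -> Cmod (h w * W w) <= M').
  { apply (max_principle (cap a d) (fun w => h w * W w)%C M' 1).
    - apply cap_closed, Ha.
    - apply cap_bounded.
    - apply ccont_on_mult; [exact Hc|]. apply ccont_ccont_on. intros z _.
      destruct (WD z) as [l Hl]. exact (cdiff_cont _ _ _ Hl).
    - apply Rle_trans with (2 := Rmax_r _ _). apply Rmult_le_pos; [exact He|left; apply exp_pos].
    - intros p Kp. rewrite Cmod_mult, WM. destruct (Req_dec (Cmod p) 1) as [E|E].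
      + left. apply Rle_trans with (2 := Rmax_r _ _).
        apply Rmult_le_compat; [apply Cmod_ge_0|left; apply exp_pos|apply Hhe; assumption|].
        assert (L := dot_le p a Ha). rewrite E in L. apply Rabs_le_between in L.
        destruct (Req_dec (lam * dot p a) lam) as [->|N]; [lra|].
        left. apply exp_increasing. nra.
      + destruct (Req_dec (dot p a) (1 - d)) as [E2|E2].
        * left. apply Rle_trans with (2 := Rmax_l _ _). rewrite E2.
          apply Rmult_le_compat_r; [left; apply exp_pos|apply HhM, Kp].
        * right. assert (Ip : capint a d p) by (destruct Kp; split; lra).
          destruct (capint_open a d p Ha Ip) as (r & Hr & K). exists r. split; [exact Hr|].
          split.
          -- intros w Hw. apply capint_cap, K. lra.
          -- intros w _ Hw. destruct (Hd w (K w (Rlt_le _ _ Hw))) as [l Hl].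
             destruct (WD w) as [m Hm]. eexists. exact (cdiff_mult _ _ w _ _ Hl Hm). }
  intros w Kw. specialize (G w Kw). rewrite Cmod_mult, WM in G.
  assert (P := exp_pos (lam * dot w a)).
  apply Rmult_le_reg_r with (1 := P). apply Rle_trans with (1 := G).
  rewrite Rmult_max_distr_r by lra. right. unfold M'.
  rewrite !Rmult_assoc, <- !exp_plus. f_equal; f_equal; f_equal; ring.
Qed.

Lemma zero_on_cap (a : C) (d : R) (h : C -> C) : Cmod a = 1 ->
  ccont_on (cap a d) h -> (forall w, capint a d w -> exists l, cdiff h w l) ->
  (forall w, cap a d w -> Cmod w = 1 -> h w = 0%C) ->
  forall w, capint a d w -> h w = 0%C.
Proof.
  intros Ha Hc Hd Hz w Kw.
  destruct (ccont_on_bounded _ h 1 (cap_closed a d Ha) (cap_bounded a d) Hc) as (M & HM & HB).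
  apply Cmod_eq_0. apply Rle_antisym; [|apply Cmod_ge_0]. apply Rnot_lt_le. intros L.
  set (s := dot w a - (1 - d)). assert (Hs : 0 < s) by (destruct Kw; unfold s; lra).
  (* With e = 0 any [lam] is allowed. For this one |h w| lam s = M, so that |h w| exp(lam s) >= |h
     w| + M exceeds the bound [M]. *)
  set (lam := M / (s * Cmod (h w))).
  assert (Hl : 0 <= lam) by (apply Rdiv_le_0_compat; nra).
  assert (T := two_constants a d M 0 lam h Ha Hl HM (Rle_refl 0) Hc Hd HB).
  specialize (T ltac:(intros z K1 K2; rewrite (Hz z K1 K2), Cmod_0; lra) w (capint_cap _ _ _ Kw)).
  fold s in T. rewrite Rmult_0_l in T. rewrite Rmax_left in T.
  2:{ apply Rmult_le_pos; [exact HM|left; apply exp_pos]. }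
  rewrite exp_Ropp in T. assert (X := exp_ineq1_le (lam * s)).
  assert (P := exp_pos (lam * s)).
  apply (Rmult_le_compat_r (exp (lam * s))) in T; [|lra].
  rewrite Rmult_assoc, Rinv_l, Rmult_1_r in T by lra.
  assert (E : Cmod (h w) * (lam * s) = M) by (unfold lam; field; lra).
  nra.
Qed.

Lemma capint_segment (a : C) (d : R) (p q : C) (t : R) : Cmod a = 1 -> 0 <= t <= 1 ->
  capint a d p -> capint a d q -> capint a d (p + t * (q - p))%C.
Proof.
  intros Ha Ht [P1 P2] [Q1 Q2]. split.
  - replace (p + t * (q - p))%C with ((1 - t)%R * p + t * q)%C
      by (rewrite RtoC_minus; ring).
    apply Rle_lt_trans with (1 := Cmod_triangle _ _).
    rewrite !Cmod_mult, !Cmod_R, !Rabs_pos_eq by lra.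
    destruct (Rle_lt_or_eq_dec 0 t) as [T|<-]; [lra|nra|lra].
  - replace (dot (p + t * (q - p))%C a) with ((1 - t) * dot p a + t * dot q a);
      [destruct (Rle_lt_or_eq_dec 0 t) as [T|<-]; [lra|nra|lra]|]. destruct p, q, a. unfold dot. simpl. ring.
Qed.

(** A chain of discs along the segment from [p] to [q]: convexity gives them a common radius [s],
    and [zero_on_disc] passes the zeros from each disc to the next centre. *)
Lemma zero_propagates (a : C) (d : R) (h : C -> C) (p q : C) (r : R) : Cmod a = 1 ->
  ccont_on (cap a d) h -> (forall w, capint a d w -> exists l, cdiff h w l) ->
  capint a d p -> capint a d q -> 0 < r ->
  (forall w, Cmod (w - p) < r -> h w = 0%C) -> h q = 0%C.
Proof.
  intros Ha Hc Hd Kp Kq Hr Hz.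
  destruct (capint_open a d p Ha Kp) as (r1 & Hr1 & D1).
  destruct (capint_open a d q Ha Kq) as (r2 & Hr2 & D2).
  set (s := Rmin r1 r2). assert (Hs : 0 < s) by (apply Rmin_glb_lt; assumption).
  assert (S1 : s <= r1) by apply Rmin_l. assert (S2 : s <= r2) by apply Rmin_r.
  (* [w] lies on the translated segment from p + v to q + v, whose ends are in the region. *)
  assert (Dt : forall t w, 0 <= t <= 1 -> Cmod (w - (p + t * (q - p))) <= s -> capint a d w).
  { intros t w Ht Hw. set (v := (w - (p + t * (q - p)))%C) in *.
    replace w with ((p + v) + t * ((q + v) - (p + v)))%C by (unfold v; ring).
    apply capint_segment; [exact Ha|exact Ht|apply D1|apply D2].
    - replace (p + v - p)%C with v by ring. lra.
    - replace (q + v - q)%C with v by ring. lra. }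
  destruct (INR_archimed s (Cmod (q - p)) Hs) as [n Hn].
  (* Enough steps that consecutive centres are closer than [s]; the successor makes [N] positive
     also when p = q. *)
  set (N := S n). assert (HN : 0 < INR N) by (apply lt_0_INR; unfold N; lia).
  assert (HNs : Cmod (q - p) < INR N * s).
  { unfold N. rewrite S_INR. lra. }
  set (c := fun k => (p + (INR k / INR N)%R * (q - p))%C).
  assert (Z : forall k, (k <= N)%nat -> exists r', 0 < r' /\
    forall w, Cmod (w - c k) < r' -> h w = 0%C).
  { induction k as [|k IH]; intros Hk.
    - exists r. split; [exact Hr|]. intros w Hw. apply Hz.
      replace (c 0%nat) with p in Hw; [exact Hw|]. unfold c. change (INR 0) with 0.
      replace (0 / INR N) with 0 by (field; lra). ring.
    - destruct IH as (r' & Hr' & Z'); [lia|].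
      assert (Tk : 0 <= INR k / INR N <= 1).
      { split; [apply Rdiv_le_0_compat; [apply pos_INR|exact HN]|].
        apply Rmult_le_reg_r with (1 := HN). unfold Rdiv. rewrite Rmult_assoc, Rinv_l by lra.
        assert (L : INR k <= INR N) by (apply le_INR; lia). lra. }
      assert (Zk : forall w, Cmod (w - c k) < s -> h w = 0%C).
      { apply (zero_on_disc h (c k) s r' Hs Hr').
        - apply ccont_on_sub with (2 := Hc). intros w Hw. apply capint_cap.
          exact (Dt _ w Tk Hw).
        - intros w Hw. apply Hd. exact (Dt _ w Tk (Rlt_le _ _ Hw)).
        - exact Z'. }
      assert (St : Cmod (c (S k) - c k) < s).
      { replace (c (S k) - c k)%C with ((/ INR N)%R * (q - p))%C.
        - rewrite Cmod_mult, Cmod_R, Rabs_pos_eq by (left; apply Rinv_0_lt_compat, HN).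
          apply Rmult_lt_reg_l with (1 := HN). rewrite <- Rmult_assoc, Rinv_r by lra. lra.
        - unfold c. rewrite S_INR.
          replace ((INR k + 1) / INR N) with (INR k / INR N + / INR N) by (field; lra).
          rewrite RtoC_plus. ring. }
      exists (s - Cmod (c (S k) - c k)). split; [lra|]. intros w Hw. apply Zk.
      pose proof (Cmod_sub_triangle w (c (S k)) (c k)). lra. }
  destruct (Z N (le_n N)) as (r' & Hr' & Z').
  replace q with (c N).
  - apply Z'. rewrite Cmod_diag. exact Hr'.
  - unfold c. replace (INR N / INR N) with 1 by (field; lra). ring.
Qed.

Lemma cexpi_surj (z : C) : Cmod z = 1 -> exists t, z = cexpi t.
Proof.
  intros Hz. assert (E := Cmod_sqr z). rewrite Hz in E. destruct z as [x y]. simpl in E.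
  assert (Hx : -1 <= x <= 1) by nra.
  assert (S := sin_acos x Hx). unfold Rsqr in S.
  replace (1 - x * x) with (y * y) in S by lra.
  destruct (Rle_dec 0 y) as [Hy|Hy].
  - exists (acos x). unfold cexpi. rewrite cos_acos by exact Hx. f_equal.
    rewrite S. symmetry. apply sqrt_square, Hy.
  - exists (- acos x). unfold cexpi. rewrite cos_neg, sin_neg, cos_acos by exact Hx. f_equal.
    rewrite S. replace (y * y) with ((- y) * (- y)) by ring. rewrite sqrt_square; lra.
Qed.

Lemma Cmod_cexpi (t : R) : Cmod (cexpi t) = 1.
Proof.
  unfold Cmod, cexpi. cbn [fst snd]. rewrite <- !Rsqr_pow2, Rplus_comm, sin2_cos2. apply sqrt_1.
Qed.

Lemma cap_limit (a : C) (d M : R) (h : nat -> C -> C) (u : R -> Cx) :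
  Cmod a = 1 -> 0 < d -> 0 <= M ->
  (forall n, ccont_on (cap a d) (h n)) ->
  (forall n w, capint a d w -> exists l, cdiff (h n) w l) ->
  (forall n w, cap a d w -> Cmod (h n w) <= M) ->
  (forall n t, cap a d (cexpi t) -> Cmod (h n (cexpi t) - u t) <= / (INR n + 1)) ->
  exists g, ccont_on (cap a (d / 2)) g /\
    (forall w, capint a (d / 2) w -> exists l, cdiff g w l) /\
    (forall t, cap a (d / 2) (cexpi t) -> g (cexpi t) = u t).
Proof.
  intros Ha Hd HM Hc Hh HB Hu.
  assert (Sub : forall w, cap a (d / 2) w -> cap a d w) by (unfold cap; intros; lra).
  assert (Cau : forall eps, 0 < eps -> exists N, forall n m z, (N <= n)%nat -> (N <= m)%nat ->
    cap a (d / 2) z -> Cmod (h n z - h m z) <= eps).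
  (* The differences are bounded by 2M, and eps lam d/2 = 2M. On the half cap the exponent is at
     least lam d/2, so exp(x) >= 1 + x brings the first term below [eps]; the factor in [e] offsets
     exp(lam (1 - dot z a)) <= exp(lam d/2) in the second. *)
  { intros eps He. set (lam := 4 * M / (d * eps)).
    assert (Hl : 0 <= lam) by (apply Rdiv_le_0_compat; nra).
    set (e := eps * exp (- (lam * (d / 2)))).
    assert (Pe : 0 < e) by (apply Rmult_lt_0_compat; [exact He|apply exp_pos]).
    destruct (small_inv (e / 2)) as [N HN]; [lra|]. exists N. intros n m z Hn Hm Kz.
    assert (T := two_constants a d (2 * M) e lam (fun w => h n w - h m w)%C Ha Hl ltac:(lra)
      (Rlt_le _ _ Pe)).
    apply Rle_trans with (1 := T
      ltac:(apply ccont_on_minus; apply Hc)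
      ltac:(intros w Kw; destruct (Hh n w Kw) as [l1 L1]; destruct (Hh m w Kw) as [l2 L2];
        exists (l1 - l2)%C; apply cdiff_minus; assumption)
      ltac:(intros w Kw; pose proof (Cmod_triangle (h n w) (- h m w)) as TT;
        rewrite Cmod_opp in TT; pose proof (HB n w Kw); pose proof (HB m w Kw);
        unfold Cminus; lra)
      ltac:(intros w Kw W1; destruct (cexpi_surj w W1) as [t ->];
        pose proof (Hu n t Kw); pose proof (Hu m t Kw) as U2;
        rewrite Cmod_sub_sym in U2;
        pose proof (Cmod_sub_triangle (h n (cexpi t)) (u t) (h m (cexpi t)));
        pose proof (HN n Hn); pose proof (HN m Hm); lra) z (Sub z Kz)).
    assert (Kz2 : d / 2 <= dot z a - (1 - d)) by (destruct Kz; lra).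
    apply Rmax_lub.
    - rewrite exp_Ropp. set (x := lam * (dot z a - (1 - d))).
      assert (P := exp_pos x). apply Rmult_le_reg_r with (1 := P).
      rewrite Rmult_assoc, Rinv_l, Rmult_1_r by lra.
      assert (X := exp_ineq1_le x). assert (X2 : lam * (d / 2) <= x).
      { apply Rmult_le_compat_l; assumption. }
      assert (E : eps * (lam * (d / 2)) = 2 * M) by (unfold lam; field; lra). nra.
    - unfold e. rewrite Rmult_assoc, <- exp_plus.
      assert (Y : - (lam * (d / 2)) + lam * (1 - dot z a) <= 0) by (destruct Kz; nra).
      assert (exp (- (lam * (d / 2)) + lam * (1 - dot z a)) <= 1); [|nra].
      assert (E0 := exp_0). destruct Y as [Y|Y]; [apply exp_increasing in Y|rewrite Y]; lra. }
  destruct (uniform_limit _ h Cau) as [g Hg]. exists g. split; [|split].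
  - apply (uniform_limit_cont _ h); [|exact Hg]. intros n. apply ccont_on_sub with (2 := Hc n).
    exact Sub.
  - intros w Kw. destruct (capint_open a (d / 2) w Ha Kw) as (r & Hr & K).
    apply (uniform_limit_holo w r h g Hr).
    + intros n. apply ccont_on_sub with (2 := Hc n). intros z Hz. apply Sub, capint_cap, K, Hz.
    + intros n z Hz. apply Hh. assert (Kz := K z (Rlt_le _ _ Hz)). destruct Kz; split; lra.
    + intros eps He. destruct (Hg eps He) as [N HN]. exists N. intros n z Hn Kz.
      apply HN; [exact Hn|]. apply capint_cap, K, Kz.
  - intros t Kt. set (w := cexpi t : C) in *. assert (E : Cmod (g w - u t) = 0).
    { apply Rle_antisym; [|apply Cmod_ge_0]. apply le_epsilon. intros e He.
      destruct (Hg (e / 2)) as [N HN]; [lra|]. destruct (small_inv (e / 2)) as [N' HN']; [lra|].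
      set (n := Nat.max N N'). specialize (HN n w ltac:(lia) Kt).
      specialize (HN' n ltac:(lia)). pose proof (Hu n t (Sub w Kt)) as U. fold w in U.
      pose proof (Cmod_sub_triangle (g w) (h n w) (u t)).
      rewrite Cmod_sub_sym in HN. lra. }
    apply Cmod_eq_0 in E. replace (g w) with (g w - u t + u t)%C by ring. rewrite E. ring.
Qed.

(** * A flat bump *)

(** The factors x^(-m) are those that differentiation of exp(-1/x) produces. *)
Definition flat (m : nat) (x : R) : R :=
  if Rlt_dec 0 x then exp (- / x) * / x ^ m else 0.

Lemma flat_pos (m : nat) (x : R) : 0 < x -> flat m x = exp (- / x) * / x ^ m.
Proof. intros H. unfold flat. destruct Rlt_dec; [reflexivity|contradiction]. Qed.

Lemma flat_neg (m : nat) (x : R) : x <= 0 -> flat m x = 0.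
Proof. intros H. unfold flat. destruct Rlt_dec; [lra|reflexivity]. Qed.

(** The n-th power of exp(-y) <= 1/y at y = 1/(n x). *)
Lemma exp_opp_inv_le (n : nat) (x : R) : 0 < x -> exp (- / x) <= (INR n * x) ^ n.
Proof.
  intros Hx. destruct n as [|n].
  - simpl. rewrite <- exp_0. left. apply exp_increasing.
    pose proof (Rinv_0_lt_compat x Hx). lra.
  - set (N := S n). assert (HN : 0 < INR N) by (apply lt_0_INR; unfold N; lia).
    assert (P : 0 < INR N * x) by (apply Rmult_lt_0_compat; assumption).
    replace (- / x) with (INR N * (- / (INR N * x))) by (field; lra).
    replace (exp (INR N * - / (INR N * x))) with (exp (- / (INR N * x)) ^ N).
    + apply pow_incr. split; [left; apply exp_pos|].
      rewrite exp_Ropp. rewrite <- (Rinv_inv (INR N * x)) at 2.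
      apply Rinv_le_contravar; [apply Rinv_0_lt_compat, P|].
      pose proof (exp_ineq1_le (/ (INR N * x))). lra.
    + generalize (- / (INR N * x)). intros y. clear. induction N as [|N IH].
      * simpl. rewrite Rmult_0_l, exp_0. reflexivity.
      * rewrite S_INR, Rmult_plus_distr_r, exp_plus, <- IH, Rmult_1_l. simpl. ring.
Qed.

Lemma flat_bound (m n : nat) (x : R) :
  0 <= flat m x <= INR (n + m) ^ (n + m) * Rabs x ^ n.
Proof.
  destruct (Rlt_dec 0 x) as [Hx|Hx].
  - rewrite flat_pos, Rabs_pos_eq by lra.
    assert (Pm : 0 < x ^ m) by (apply pow_lt, Hx). split.
    + apply Rmult_le_pos; [left; apply exp_pos|left; apply Rinv_0_lt_compat, Pm].
    + apply Rmult_le_reg_r with (1 := Pm). rewrite Rmult_assoc, Rinv_l, Rmult_1_r by lra.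
      apply Rle_trans with (1 := exp_opp_inv_le (n + m) x Hx).
      rewrite Rpow_mult_distr, (pow_add x). right. ring.
  - rewrite flat_neg by lra. split; [lra|].
    apply Rmult_le_pos; apply pow_le; [apply pos_INR|apply Rabs_pos].
Qed.

(** Trigonometric polynomials as syntax: differentiation becomes an operation on terms, and
    boundedness follows by induction. *)
Inductive trig : Type :=
| TConst (c : R) | TSin | TCos | TAdd (p q : trig) | TMul (p q : trig).

Fixpoint teval (p : trig) (t : R) : R :=
  match p with
  | TConst c => c
  | TSin => sin t
  | TCos => cos t
  | TAdd p q => teval p t + teval q t
  | TMul p q => teval p t * teval q t
  end.

Fixpoint tderiv (p : trig) : trig :=
  match p with
  | TConst _ => TConst 0
  | TSin => TCos
  | TCos => TMul (TConst (-1)) TSin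
  | TAdd p q => TAdd (tderiv p) (tderiv q)
  | TMul p q => TAdd (TMul (tderiv p) q) (TMul p (tderiv q))
  end.

Lemma teval_derive (p : trig) (t : R) : is_derive (teval p) t (teval (tderiv p) t).
Proof.
  induction p as [c| | |p IHp q IHq|p IHp q IHq]; simpl.
  - apply @is_derive_const.
  - apply is_derive_sin.
  - replace (-1 * sin t) with (- sin t) by ring. apply is_derive_cos.
  - exact (is_derive_plus (teval p) (teval q) t _ _ IHp IHq).
  - exact (is_derive_mult (teval p) (teval q) t _ _ IHp IHq Rmult_comm).
Qed.

Lemma teval_bounded (p : trig) : exists B, 0 <= B /\ forall t, Rabs (teval p t) <= B.
Proof.
  induction p as [c| | |p [A [HA1 HA]] q [B [HB1 HB]]|p [A [HA1 HA]] q [B [HB1 HB]]]; simpl.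
  - exists (Rabs c). split; [apply Rabs_pos|]. intros; lra.
  - exists 1. split; [lra|]. intros t. apply Rabs_le, SIN_bound.
  - exists 1. split; [lra|]. intros t. apply Rabs_le, COS_bound.
  - exists (A + B). split; [lra|]. intros t. apply Rle_trans with (1 := Rabs_triang _ _).
    specialize (HA t). specialize (HB t). lra.
  - exists (A * B). split; [nra|]. intros t. rewrite Rabs_mult.
    apply Rmult_le_compat; try apply Rabs_pos; auto.
Qed.

(** Composition with the sine makes the flat function 2 pi-periodic without gluing; it vanishes
    wherever sin t <= 0. The family is stable under differentiation. *)
Definition tflat (s : trig * nat) (t : R) : R := teval (fst s) t * flat (snd s) (sin t).

(* With [s = sin t], the derivative of [p s^(-m) e^(-1/s)] is
   [(p' s^2 - m p s cos t + p cos t) s^(-m-2) e^(-1/s)]. *)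
Definition tnext (s : trig * nat) : trig * nat :=
  let (p, m) := s in
  (TAdd (TMul (tderiv p) (TMul TSin TSin))
        (TAdd (TMul (TConst (- INR m)) (TMul p (TMul TCos TSin))) (TMul p TCos)), (m + 2)%nat).

(** Quadratic vanishing at the zeros of the sine is what makes the derivative exist and vanish
    there. *)
Lemma tflat_quadratic (s : trig * nat) : exists B, 0 <= B /\
  forall t, Rabs (tflat s t) <= B * Rabs (sin t) ^ 2.
Proof.
  destruct s as [p m]. destruct (teval_bounded p) as (A & HA & HB).
  exists (A * INR (2 + m) ^ (2 + m)).
  assert (P : 0 <= INR (2 + m) ^ (2 + m)) by (apply pow_le, pos_INR).
  split; [apply Rmult_le_pos; assumption|].
  intros t. unfold tflat. cbn [fst snd]. rewrite Rabs_mult, Rmult_assoc.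
  destruct (flat_bound m 2 (sin t)) as [F1 F2]. rewrite (Rabs_pos_eq (flat _ _)) by exact F1.
  apply Rmult_le_compat; [apply Rabs_pos|exact F1|apply HB|exact F2].
Qed.

Lemma tflat_bounded (s : trig * nat) : exists B, 0 <= B /\ forall t, Rabs (tflat s t) <= B.
Proof.
  destruct (tflat_quadratic s) as (B & HB & H). exists B. split; [exact HB|].
  intros t. apply Rle_trans with (1 := H t).
  assert (L : Rabs (sin t) <= 1) by (apply Rabs_le, SIN_bound). pose proof (Rabs_pos (sin t)). assert (Rabs (sin t) ^ 2 <= 1) by nra. nra.
Qed.

Lemma continuous_sin_at (t : R) : continuous sin t.
Proof. apply (ex_derive_continuous sin). exists (cos t). apply is_derive_sin. Qed.

Lemma locally_lt (f : R -> R) (t c : R) : continuous f t -> f t < c ->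
  locally t (fun x => f x < c).
Proof. intros Hf H. apply (Hf (fun y => y < c)). apply (open_lt c). exact H. Qed.

Lemma locally_gt (f : R -> R) (t c : R) : continuous f t -> c < f t ->
  locally t (fun x => c < f x).
Proof. intros Hf H. apply (Hf (fun y => c < y)). apply (open_gt c). exact H. Qed.

Lemma tflat_derive (s : trig * nat) (t : R) : is_derive (tflat s) t (tflat (tnext s) t).
Proof.
  destruct s as [p m]. destruct (Rtotal_order (sin t) 0) as [H|[H|H]].
  - apply (is_derive_ext_loc (fun _ => 0)).
    + generalize (locally_lt sin t 0 (continuous_sin_at t) H). apply filter_imp.
      intros x Hx. unfold tflat. rewrite flat_neg by lra. rewrite Rmult_0_r. reflexivity.
    + unfold tflat. rewrite flat_neg, Rmult_0_r by lra. apply @is_derive_const.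
  (* At a zero of the sine |sin (t + h)| <= |h|, so the difference quotient is at most B |h|, which
     the choice eps / (B + 1) of radius controls. *)
  - assert (Z : forall q, tflat q t = 0).
    { intros q. unfold tflat. rewrite flat_neg by lra. ring. }
    rewrite Z.
    destruct (tflat_quadratic (p, m)) as (B & HB & Q).
    apply is_derive_Reals. intros eps He.
    assert (Hd : 0 < eps / (B + 1)) by (apply Rdiv_lt_0_compat; lra).
    exists (mkposreal _ Hd). intros h Hh0 Hh. simpl in Hh.
    rewrite Z. specialize (Q (t + h)). rewrite !Rminus_0_r. unfold Rdiv. rewrite Rabs_mult, Rabs_inv.
    assert (P : 0 < Rabs h) by (apply Rabs_pos_lt, Hh0).
    apply Rmult_lt_reg_r with (1 := P). rewrite Rmult_assoc, Rinv_l, Rmult_1_r by lra.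
    assert (S1 : Rabs (sin (t + h)) <= Rabs h).
    { rewrite sin_plus, H, Rmult_0_l, Rplus_0_l, Rabs_mult.
      assert (Rabs (cos t) <= 1) by (apply Rabs_le, COS_bound).
      pose proof (Rabs_sin_le h). pose proof (Rabs_pos (cos t)). pose proof (Rabs_pos (sin h)). nra. }
    apply (Rmult_lt_compat_r (B + 1)) in Hh; [|lra].
    replace (eps / (B + 1) * (B + 1)) with eps in Hh by (field; lra).
    pose proof (Rabs_pos (sin (t + h))). apply Rle_lt_trans with (1 := Q).
    apply Rle_lt_trans with (B * (Rabs h * Rabs h)); [|nra].
    apply Rmult_le_compat_l; [exact HB|]. simpl. nra.
  - apply (is_derive_ext_loc (fun x => teval p x * (exp (- / sin x) * / sin x ^ m))).
    + generalize (locally_gt sin t 0 (continuous_sin_at t) H). apply filter_imp.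
      intros x Hx. unfold tflat. cbn [fst snd]. rewrite flat_pos by exact Hx. reflexivity.
    + unfold tflat, tnext. cbn [fst snd]. rewrite flat_pos by exact H.
      assert (D : is_derive (fun x => exp (- / sin x) * / sin x ^ m) t
        (exp (- / sin t) * / sin t ^ (m + 2) * (cos t - INR m * cos t * sin t))).
      { auto_derive.
        - split; [lra|]. split; [|exact I]. apply pow_nonzero. lra.
        - rewrite pow_add. destruct m as [|m]; [simpl; field; lra|].
          simpl pred. rewrite <- !tech_pow_Rmult. field.
          repeat split; try apply pow_nonzero; lra. }
      assert (E := is_derive_mult _ _ t _ _ (teval_derive p t) D Rmult_comm).
      evar_last; [exact E|]. unfold plus, mult; simpl.
      rewrite pow_add. field. repeat split; try apply pow_nonzero; lra.
Qed.

(** [j] is the order of the derivative: [bump theta] is already the sequence that [derivs] asks for,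
    starting from exp(-1/sin(t - theta)), cut off to 0 where the sine is not positive. *)
Definition bump (theta : R) (j : nat) (t : R) : Cx :=
  (tflat (Nat.iter j tnext (TConst 1, O)) (t - theta), 0).

Lemma bump_0 (theta t : R) : bump theta 0 t = (flat 0 (sin (t - theta)), 0).
Proof. unfold bump, tflat. simpl. f_equal. ring. Qed.

Lemma bump_derive (theta : R) (j : nat) (t : R) :
  is_derive (fun s => fst (bump theta j s)) t (fst (bump theta (S j) t)).
Proof.
  unfold bump. simpl.
  assert (D : is_derive (fun s => s - theta) t 1) by (auto_derive; [exact I|ring]).
  assert (E := is_derive_comp (tflat (Nat.iter j tnext (TConst 1, O))) (fun s => s - theta) t _ _
    (tflat_derive _ _) D).
  evar_last; [exact E|]. unfold scal; simpl. unfold mult; simpl. apply Rmult_1_l.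
Qed.

Lemma bump_derivs (theta : R) (k : ext_nat) : derivs k (bump theta 0) (bump theta).
Proof.
  split; [reflexivity|]. split.
  - intros j _ t. split; [apply is_derive_Reals, bump_derive|].
    exact (derivable_pt_lim_const 0 t).
  - intros j _. split; intros t; apply continuity_pt_filterlim.
    + apply (ex_derive_continuous (fun s => fst (bump theta j s))). eexists. apply bump_derive.
    + apply continuous_const.
Qed.

Lemma bump_Ck (theta : R) (k : ext_nat) : Ck k (bump theta 0).
Proof.
  split; [|exists (bump theta); apply bump_derivs].
  intros t. rewrite !bump_0.
  replace (t + 2 * PI - theta) with (t - theta + 2 * PI) by ring.
  rewrite sin_plus, sin_2PI, cos_2PI, Rmult_0_r, Rmult_1_r, Rplus_0_r. reflexivity.
Qed.

Lemma bump_bounded (theta : R) (j : nat) : exists B, 0 <= B /\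
  forall t, Cmod (bump theta j t) <= B.
Proof.
  destruct (tflat_bounded (Nat.iter j tnext (TConst 1, O))) as (B & HB & H).
  exists B. split; [exact HB|]. intros t. apply Rle_trans with (1 := Cmod_le_abs _).
  unfold bump. simpl. rewrite Rabs_R0, Rplus_0_r. apply H.
Qed.

Lemma bump_bounded_upto (theta : R) (N : nat) : exists B, 0 <= B /\
  forall j, (j <= N)%nat -> forall t, Cmod (bump theta j t) <= B.
Proof.
  induction N as [|N (A & HA & HN)].
  - destruct (bump_bounded theta 0) as (B & HB & H). exists B. split; [exact HB|].
    intros j Hj. replace j with O by lia. exact H.
  - destruct (bump_bounded theta (S N)) as (B & HB & H). exists (A + B). split; [lra|].
    intros j Hj t. destruct (Nat.eq_dec j (S N)) as [->|E].
    + specialize (H t). lra.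
    + specialize (HN j ltac:(lia) t). lra.
Qed.

(** * Extensions near a boundary point *)

(** The extension property of [U3] transferred to a closed segment, which is compact and convex;
    [U3_of_no_cap_ext] and [cap_ext_not_U3] give the equivalence. *)
Definition cap_ext (a : C) (d : R) (h : C -> C) (g : R -> Cx) : Prop :=
  ccont_on (cap a d) h /\ (forall w, capint a d w -> exists l, cdiff h w l) /\
  (forall t, cap a d (cexpi t) -> h (cexpi t) = g t).

Lemma cap_mono (a : C) (d d' : R) (z : C) : d' <= d -> cap a d' z -> cap a d z.
Proof. unfold cap. lra. Qed.

Lemma capint_mono (a : C) (d d' : R) (z : C) : d' <= d -> capint a d' z -> capint a d z.
Proof. unfold capint. lra. Qed.

Lemma cap_ext_mono (a : C) (d d' : R) (h : C -> C) (g : R -> Cx) : d' <= d ->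
  cap_ext a d h g -> cap_ext a d' h g.
Proof.
  intros Hd (H1 & H2 & H3). split; [|split].
  - apply ccont_on_sub with (2 := H1). intros z. apply cap_mono, Hd.
  - intros w Hw. apply H2. revert Hw. apply capint_mono, Hd.
  - intros t Ht. apply H3. revert Ht. apply cap_mono, Hd.
Qed.

Lemma cap_near (a : C) (d r : R) (z : C) : Cmod a = 1 -> 0 < r -> 2 * d < r * r ->
  cap a d z -> Cmod (z - a) < r.
Proof.
  intros Ha Hr Hd [H1 H2]. pose proof (dot_dist z a Ha) as E.
  pose proof (Cmod_ge_0 z). pose proof (Cmod_ge_0 (z - a)).
  assert (Cmod z * Cmod z <= 1) by nra. nra.
Qed.

Lemma dot_near (a z : C) : Cmod a = 1 -> 1 - Cmod (z - a) <= dot z a.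
Proof.
  intros Ha. pose proof (dot_lipschitz z a a Ha) as L. rewrite (dot_self a Ha) in L.
  apply Rabs_le_between in L. lra.
Qed.

(** [retract] pulls a point beyond the chord along the line to [a] until it meets the chord, and
    fixes the segment; [shrink] is the ratio of that contraction. *)
Definition shrink (a : C) (d : R) (z : C) : R := d / Rmax d (1 - dot z a).
Definition retract (a : C) (d : R) (z : C) : C := (a + shrink a d z * (z - a))%C.

Lemma shrink_bounds (a : C) (d : R) (z : C) : 0 < d ->
  0 <= shrink a d z <= 1 /\ shrink a d z * (1 - dot z a) <= d.
Proof.
  intros Hd. unfold shrink. set (m := Rmax d (1 - dot z a)).
  assert (M1 : d <= m) by apply Rmax_l. assert (M2 : 1 - dot z a <= m) by apply Rmax_r.
  assert (P : 0 <= d / m) by (apply Rdiv_le_0_compat; lra).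
  assert (E : d / m * m = d) by (field; lra).
  split; [split; [exact P|]|]; nra.
Qed.

Lemma shrink_1 (a : C) (d : R) (z : C) : 0 < d -> 1 - d <= dot z a -> shrink a d z = 1.
Proof. intros Hd H. unfold shrink. rewrite Rmax_left by lra. field. lra. Qed.

Lemma retract_id (a : C) (d : R) (z : C) : 0 < d -> 1 - d <= dot z a -> retract a d z = z.
Proof. intros Hd H. unfold retract. rewrite shrink_1 by assumption. ring. Qed.

Lemma retract_cap (a : C) (d : R) (z : C) : Cmod a = 1 -> 0 < d -> Cmod z <= 1 ->
  cap a d (retract a d z).
Proof.
  intros Ha Hd Hz. destruct (shrink_bounds a d z Hd) as [S1 S2]. unfold retract.
  set (s := shrink a d z) in *. split.
  - replace (a + s * (z - a))%C with ((1 - s)%R * a + s * z)%C by (rewrite RtoC_minus; ring).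
    apply Rle_trans with (1 := Cmod_triangle _ _).
    rewrite !Cmod_mult, !Cmod_R, !Rabs_pos_eq, Ha by lra. nra.
  - replace (dot (a + s * (z - a))%C a) with ((1 - s) * dot a a + s * dot z a).
    + rewrite (dot_self a Ha). lra.
    + destruct z, a. unfold dot. simpl. ring.
Qed.

(** Both denominators are at least [d], so the difference of the quotients is at most the difference
    of the denominators over [d]. *)
Lemma shrink_lipschitz (a : C) (d : R) (z w : C) : Cmod a = 1 -> 0 < d ->
  Rabs (shrink a d w - shrink a d z) <= Cmod (w - z) / d.
Proof.
  intros Ha Hd. unfold shrink.
  assert (L := dot_lipschitz w z a Ha). apply Rabs_le_between in L.
  set (m := Rmax d (1 - dot w a)). set (n := Rmax d (1 - dot z a)).
  assert (M1 : d <= m) by apply Rmax_l. assert (N1 : d <= n) by apply Rmax_l.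
  assert (D : Rabs (n - m) <= Cmod (w - z)).
  { apply Rabs_le. unfold n, m, Rmax. destruct Rle_dec, Rle_dec; lra. }
  replace (d / m - d / n) with ((n - m) * (d / (m * n))) by (field; lra).
  rewrite Rabs_mult. apply Rmult_le_compat; try apply Rabs_pos; [exact D|].
  assert (P : 0 < m * n) by (apply Rmult_lt_0_compat; lra).
  rewrite Rabs_pos_eq by (apply Rdiv_le_0_compat; lra).
  apply Rmult_le_reg_r with (1 := P). unfold Rdiv. rewrite Rmult_assoc, Rinv_l, Rmult_1_r by lra.
  apply Rmult_le_reg_l with (1 := Hd). rewrite <- Rmult_assoc, Rinv_r, Rmult_1_l by lra. nra.
Qed.

Lemma retract_lipschitz (a : C) (d : R) (z w : C) : Cmod a = 1 -> 0 < d ->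
  Cmod z <= 1 ->
  Cmod (retract a d w - retract a d z) <= (1 + 2 / d) * Cmod (w - z).
Proof.
  intros Ha Hd Hz. destruct (shrink_bounds a d w Hd) as [S1 _].
  assert (L := shrink_lipschitz a d z w Ha Hd). unfold retract.
  set (s := shrink a d w) in *. set (t := shrink a d z) in *.
  replace (a + s * (w - a) - (a + t * (z - a)))%C
    with (s * (w - z) + (s - t)%R * (z - a))%C by (rewrite RtoC_minus; ring).
  apply Rle_trans with (1 := Cmod_triangle _ _).
  rewrite !Cmod_mult, !Cmod_R, (Rabs_pos_eq s) by lra.
  assert (A : Cmod (z - a) <= 2).
  { unfold Cminus. apply Rle_trans with (1 := Cmod_triangle _ _). rewrite Cmod_opp. lra. }
  pose proof (Cmod_ge_0 (w - z)). pose proof (Cmod_ge_0 (z - a)). pose proof (Rabs_pos (s - t)).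
  assert (Rabs (s - t) * Cmod (z - a) <= Cmod (w - z) / d * 2) by (apply Rmult_le_compat; assumption).
  replace ((1 + 2 / d) * Cmod (w - z)) with (Cmod (w - z) + Cmod (w - z) / d * 2) by (field; lra).
  nra.
Qed.

Lemma U3_of_no_cap_ext (a : Cx) (k : ext_nat) (g : R -> Cx) : onT a -> Ck k g ->
  ~ (exists d h, 0 < d /\ cap_ext a d h g) -> U3 a k g.
Proof.
  intros Ha Hg N. split; [exact Hg|]. intros (r & h & Hr & Hc & Hh & E). apply N.
  (* Points of the cap of height d satisfy |z - a|^2 <= 2d, here r^2 / 2, so the cap lies in the
     disc of radius [r]. *)
  change (Cmod a = 1) in Ha. exists (r * r / 4), h. split; [nra|].
  assert (Near : forall z, cap a (r * r / 4) z -> Cmod (z - a) < r).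
  { intros z. apply cap_near; [exact Ha|exact Hr|nra]. }
  split; [|split].
  - apply ccont_on_sub with (2 := Hc). intros z Hz.
    destruct (Req_dec (Cmod z) 1) as [L|L]; [left; exact L|right].
    split; [exact (Near z Hz)|]. destruct Hz as [Hz _]. change (Cmod z < 1). lra.
  - intros w Hw. apply Hh. split; [exact (Near w (capint_cap _ _ _ Hw))|apply Hw].
  - intros t Ht. apply E. exact (Near _ Ht).
Qed.

(** Composition with [retract] extends [h] continuously to the whole closed disc. By [dot_near],
    P(a,d) lies inside the segment, where the retraction is the identity and holomorphy is
    preserved. *)
Lemma cap_ext_not_U3 (a : Cx) (k : ext_nat) (g : R -> Cx) (d : R) (h : C -> C) : onT a ->
  0 < d -> cap_ext a d h g -> ~ U3 a k g.
Proof.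
  intros Ha Hd (Hc & Hh & E) [_ N]. apply N. change (Cmod a = 1) in Ha.
  assert (Pint : forall z, inP a d z -> capint a d z).
  { intros z [H1 H2]. change (Cmod (z - a) < d) in H1. split; [exact H2|].
    pose proof (dot_near a z Ha). lra. }
  exists d, (fun z => h (retract a d z)). split; [exact Hd|]. split; [|split].
  - intros z Hz eps He.
    assert (Cl : forall z, onT z \/ inP a d z -> Cmod z <= 1).
    { intros w [Hw|[_ Hw]]; [right; exact Hw|left; exact Hw]. }
    destruct (Hc (retract a d z) (retract_cap a d z Ha Hd (Cl z Hz)) eps He) as (e & Pe & D).
    assert (P : 0 < 1 + 2 / d).
    { assert (0 < 2 / d) by (apply Rdiv_lt_0_compat; lra). lra. }
    exists (e / (1 + 2 / d)). split; [apply Rdiv_lt_0_compat; assumption|].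
    intros w Hw Hwz. apply D; [apply retract_cap; auto|].
    apply Rle_lt_trans with (1 := retract_lipschitz a d z w Ha Hd (Cl z Hz)).
    change (Cmod (w - z) < e / (1 + 2 / d)) in Hwz.
    apply (Rmult_lt_compat_l _ _ _ P) in Hwz.
    replace ((1 + 2 / d) * (e / (1 + 2 / d))) with e in Hwz; [exact Hwz|].
    field. split; [lra|]. intros E0. assert (d * (1 + 2 / d) = d + 2) by (field; lra). nra.
  - intros z Hz. apply Pint in Hz. destruct (Hh z Hz) as [l Hl]. exists l.
    destruct (capint_open a d z Ha Hz) as (r & Hr & K).
    apply (cdiff_ext h (fun z => h (retract a d z)) z l r Hr); [|exact Hl].
    intros w Hw. rewrite retract_id; [reflexivity|exact Hd|].
    left. apply (K w). lra.
  - intros t Ht. change (Cmod (cexpi t - a) < d) in Ht.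
    assert (D := dot_near a (cexpi t) Ha). rewrite retract_id by lra.
    apply E. split; [right; apply Cmod_cexpi|lra].
Qed.

(** * Derivative sequences and neighbourhoods in C^k(T) *)

Lemma le_ext_0 (k : ext_nat) : le_ext 0 k.
Proof. destruct k; simpl; [lia|exact I]. Qed.

Lemma le_ext_trans (i j : nat) (k : ext_nat) : (i <= j)%nat -> le_ext j k -> le_ext i k.
Proof. destruct k; simpl; [lia|trivial]. Qed.

(** Since [near] quantifies over all derivative sequences, this is what allows computing with one
    chosen sequence. *)
Lemma derivs_unique (k : ext_nat) (g : R -> Cx) (d d' : nat -> R -> Cx) :
  derivs k g d -> derivs k g d' -> forall j, le_ext j k -> forall t, d j t = d' j t.
Proof.
  intros (E & D & _) (E' & D' & _). induction j as [|j IH]; intros Hj t.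
  - rewrite E, E'. reflexivity.
  - assert (Hj' : le_ext j k) by (apply le_ext_trans with (2 := Hj); lia).
    destruct (D j Hj t) as [D1 D2]. destruct (D' j Hj t) as [D1' D2'].
    assert (Ef : forall s, d j s = d' j s) by (intros; apply IH, Hj').
    rewrite (surjective_pairing (d (S j) t)), (surjective_pairing (d' (S j) t)). f_equal.
    + apply (uniqueness_limite (fun s => fst (d j s)) t); [exact D1|].
      apply is_derive_Reals. apply (is_derive_ext (fun s => fst (d' j s))).
      * intros s. rewrite Ef. reflexivity.
      * apply is_derive_Reals, D1'.
    + apply (uniqueness_limite (fun s => snd (d j s)) t); [exact D2|].
      apply is_derive_Reals. apply (is_derive_ext (fun s => snd (d' j s))).
      * intros s. rewrite Ef. reflexivity.
      * apply is_derive_Reals, D2'.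
Qed.

Lemma near_refl (k : ext_nat) (N : nat) (eps : R) (g : R -> Cx) : le_ext N k -> 0 < eps ->
  near k N eps g g.
Proof.
  intros HN He df dg Hf Hg j Hj t. change (Cmod (df j t - dg j t) <= eps).
  rewrite (derivs_unique k g df dg Hf Hg j) by (apply le_ext_trans with N; assumption).
  rewrite Cmod_diag. lra.
Qed.

Lemma near_trans (k : ext_nat) (N : nat) (e1 e2 : R) (f g h : R -> Cx) : Ck k g ->
  near k N e1 f g -> near k N e2 g h -> near k N (e1 + e2) f h.
Proof.
  intros [_ [dg Hg]] H1 H2 df dh Hf Hh j Hj t. change (Cmod (df j t - dh j t) <= e1 + e2).
  apply Rle_trans with (1 := Cmod_sub_triangle _ (dg j t) _).
  apply Rplus_le_compat; [exact (H1 df dg Hf Hg j Hj t)|exact (H2 dg dh Hg Hh j Hj t)].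
Qed.

Lemma near_dist (k : ext_nat) (e : R) (f g : R -> Cx) (t : R) : Ck k f -> Ck k g ->
  near k 0 e f g -> Cmod (f t - g t) <= e.
Proof.
  intros [_ [df Hf]] [_ [dg Hg]] H. specialize (H df dg Hf Hg O (le_n O) t).
  destruct Hf as [<- _]. destruct Hg as [<- _]. exact H.
Qed.

(** The set E n. A single index serves both for the bound and for the height, so that the union is
    countable and exhausts the extendable functions. *)
Definition bounded_ext (a : C) (n : nat) (g : R -> Cx) : Prop :=
  exists h, cap_ext a (/ (INR n + 1)) h g /\
    forall w, cap a (/ (INR n + 1)) w -> Cmod (h w) <= INR n.

Lemma cap_ext_bounded_ext (a : C) (d : R) (h : C -> C) (g : R -> Cx) : Cmod a = 1 ->
  0 < d -> cap_ext a d h g -> exists n, bounded_ext a n g.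
Proof.
  intros Ha Hd Hh.
  destruct (ccont_on_bounded _ h 1 (cap_closed a d Ha) (cap_bounded a d) (proj1 Hh)) as (M & _ & HM).
  destruct (small_inv d Hd) as [N HN]. destruct (INR_archimed 1 M Rlt_0_1) as [m Hm].
  set (n := Nat.max N m). assert (L := HN n ltac:(lia)).
  assert (Lm : INR m <= INR n) by (apply le_INR; lia).
  exists n, h. split.
  - apply cap_ext_mono with (2 := Hh). lra.
  - intros w Hw. apply Rle_trans with M; [|lra]. apply HM. revert Hw. apply cap_mono. lra.
Qed.

(** The limit need not be placed in E n again: an extension to a lower segment already keeps it out
    of [U3]. *)
Lemma bounded_ext_closed (a : C) (n : nat) (g : R -> Cx) (f : nat -> R -> Cx) : Cmod a = 1 ->
  (forall j, bounded_ext a n (f j)) ->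
  (forall j t, Cmod (f j t - g t) <= / (INR j + 1)) ->
  exists d h, 0 < d /\ cap_ext a d h g.
Proof.
  intros Ha Hf Hfg.
  set (h := fun j => proj1_sig (constructive_indefinite_description _ (Hf j))).
  assert (Hh : forall j, cap_ext a (/ (INR n + 1)) (h j) (f j) /\
    forall w, cap a (/ (INR n + 1)) w -> Cmod (h j w) <= INR n).
  { intros j. exact (proj2_sig (constructive_indefinite_description _ (Hf j))). }
  assert (Hd : 0 < / (INR n + 1)).
  { apply Rinv_0_lt_compat. pose proof (pos_INR n). lra. }
  set (d := / (INR n + 1)) in *.
  destruct (cap_limit a d (INR n) h g Ha Hd (pos_INR n)) as (u & U1 & U2 & U3).
  - intros j. apply Hh.
  - intros j. apply Hh.
  - intros j. apply Hh.
  - intros j t Kt. destruct (Hh j) as [(_ & _ & E) _]. rewrite (E t Kt). apply Hfg.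
  - exists (d / 2), u. split; [lra|]. split; [exact U1|]. split; [exact U2|exact U3].
Qed.

(** * The bump has no extension; density *)

Lemma cos_ge_quadratic (x : R) : 0 <= x -> 1 - x * x / 2 <= cos x.
Proof.
  intros Hx. replace x with (2 * (x / 2)) at 3 by field. rewrite cos_2a_sin.
  pose proof (Rabs_sin_le (x / 2)) as L. rewrite (Rabs_pos_eq (x / 2)) in L by lra.
  apply Rabs_le_between in L. nra.
Qed.

(* On the arc before [a] the bump vanishes, so an extension would vanish on a cap there, hence on
   the whole convex region, hence also on the arc after [a]. *)
Lemma bump_no_cap_ext (theta d : R) (h : C -> C) : 0 < d ->
  ~ cap_ext (cexpi theta) d h (bump theta 0).
Proof.
  intros Hd (Hc & Hh & E). set (a := cexpi theta : C) in *.
  assert (Ha : Cmod a = 1) by apply Cmod_cexpi.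
  (* The angle from [a] to the two test points: cos al >= 1 - d/2 leaves a margin d/2 inside the
     segment, and al <= 1 makes sin al positive. *)
  set (al := Rmin 1 d). assert (A0 : 0 < al) by (apply Rmin_glb_lt; lra).
  assert (A1 : al <= 1) by apply Rmin_l. assert (A2 : al <= d) by apply Rmin_r.
  assert (Hcos : 1 - d / 2 <= cos al).
  { apply Rle_trans with (2 := cos_ge_quadratic al (Rlt_le _ _ A0)). nra. }
  assert (Hsin : 0 < sin al).
  { apply sin_gt_0; [exact A0|]. pose proof PI2_1. lra. }
  assert (Sb := SIN_bound al). assert (Cb := COS_bound al).
  assert (Dot : forall t, dot (cexpi t) a = cos (t - theta)).
  { intros t. unfold dot, a, cexpi. simpl. rewrite cos_minus. ring. }
  (* The tangent vector i a; the sign of the product with it tells on which side of [a] a point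
     lies. *)
  set (ia := (- sin theta, cos theta) : C).
  assert (Hia : Cmod ia = 1).
  { rewrite <- Ha. unfold Cmod, ia, a, cexpi. simpl. f_equal. ring. }
  assert (Cross : forall t, dot (cexpi t) ia = sin (t - theta)).
  { intros t. unfold dot, ia, cexpi. simpl. rewrite sin_minus. ring. }
  set (z1 := cexpi (theta - al) : C). assert (H1 : Cmod z1 = 1) by apply Cmod_cexpi.
  (* Makes the cap at [z1] of diameter so small that its points are within d/2 and within sin al of
     [z1]: it stays in the large segment and strictly on the side where the bump vanishes. *)
  set (d1 := Rmin (d * d / 16) (sin al * sin al / 4)).
  assert (D0 : 0 < d1) by (apply Rmin_glb_lt; nra).
  assert (D1 : d1 <= d * d / 16) by apply Rmin_l.
  assert (D2 : d1 <= sin al * sin al / 4) by apply Rmin_r.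
  assert (Z1 : dot z1 a = cos al).
  { unfold z1. rewrite Dot. replace (theta - al - theta) with (- al) by ring. apply cos_neg. }
  assert (Z1' : dot z1 ia = - sin al).
  { unfold z1. rewrite Cross. replace (theta - al - theta) with (- al) by ring. apply sin_neg. }
  assert (Near1 : forall w, cap z1 d1 w -> 1 - d < dot w a).
  { intros w Hw. assert (L := cap_near z1 d1 (d / 2) w H1 ltac:(lra) ltac:(nra) Hw).
    assert (L2 := dot_lipschitz w z1 a Ha). apply Rabs_le_between in L2. lra. }
  assert (Near2 : forall w, cap z1 d1 w -> dot w ia < 0).
  { intros w Hw. assert (L := cap_near z1 d1 (sin al) w H1 Hsin ltac:(nra) Hw).
    assert (L2 := dot_lipschitz w z1 ia Hia). apply Rabs_le_between in L2. lra. }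
  assert (Sub : forall w, cap z1 d1 w -> cap a d w).
  { intros w Hw. split; [apply Hw|left; apply Near1, Hw]. }
  assert (Zcap : forall w, capint z1 d1 w -> h w = 0%C).
  { apply (zero_on_cap z1 d1 h H1).
    - apply ccont_on_sub with (2 := Hc). exact Sub.
    - intros w Hw. apply Hh. split; [apply Hw|apply Near1, capint_cap, Hw].
    - intros w Hw W1. destruct (cexpi_surj w W1) as [t ->]. rewrite (E t (Sub _ Hw)), bump_0.
      assert (L := Near2 _ Hw). rewrite Cross in L. rewrite flat_neg by lra. reflexivity. }
  assert (Scale : forall (z b : C) (s : R), dot (s * z)%C b = s * dot z b).
  { intros z b s. destruct z, b. unfold dot. simpl. ring. }
  set (p := ((1 - d1 / 2)%R * z1)%C).
  assert (Kp : capint z1 d1 p).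
  { unfold p. split.
    - rewrite Cmod_mult, Cmod_R, H1, Rabs_pos_eq by nra. lra.
    - rewrite Scale, dot_self by exact H1. lra. }
  destruct (capint_open z1 d1 p H1 Kp) as (r & Hr & Br).
  assert (Zall : forall q, capint a d q -> h q = 0%C).
  { intros q Kq. apply (zero_propagates a d h p q r Ha Hc Hh); try assumption.
    - split; [apply Kp|apply Near1, capint_cap, Kp].
    - intros w Hw. apply Zcap, Br. lra. }
  (* The mirror image of [z1], where the bump is exp(-1/sin al) > 0. *)
  set (z2 := cexpi (theta + al) : C). assert (H2 : Cmod z2 = 1) by apply Cmod_cexpi.
  assert (Z2 : dot z2 a = cos al).
  { unfold z2. rewrite Dot. f_equal. ring. }
  assert (K2 : cap a d z2) by (split; lra).
  assert (N2 : 0 < Cmod (h z2)).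
  { unfold z2. rewrite (E _ K2), bump_0. replace (theta + al - theta) with al by ring.
    apply Cmod_gt_0. intros Z. apply (f_equal fst) in Z. simpl in Z.
    rewrite flat_pos in Z by exact Hsin. simpl in Z. rewrite Rinv_1, Rmult_1_r in Z.
    pose proof (exp_pos (- / sin al)). lra. }
  destruct (Hc z2 K2 _ N2) as (e & He & D).
  (* [z2] is moved radially inwards by [s]: d/4 keeps it in the open segment, where [h] is 0, and
     e/2 keeps it where continuity forces [h] to be nonzero. *)
  set (s := Rmin (1 / 2) (Rmin (d / 4) (e / 2))).
  assert (Hs : 0 < s) by (repeat apply Rmin_glb_lt; lra).
  assert (S1 : s <= 1 / 2) by apply Rmin_l.
  assert (S2 : s <= d / 4) by (apply Rle_trans with (1 := Rmin_r _ _); apply Rmin_l).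
  assert (S3 : s <= e / 2) by (apply Rle_trans with (1 := Rmin_r _ _); apply Rmin_r).
  set (q := ((1 - s)%R * z2)%C).
  assert (Kq : capint a d q).
  { unfold q. split.
    - rewrite Cmod_mult, Cmod_R, H2, Rabs_pos_eq by lra. lra.
    - rewrite Scale, Z2. nra. }
  specialize (D q (capint_cap _ _ _ Kq)). rewrite (Zall q Kq) in D.
  replace (0 - h z2)%C with (- h z2)%C in D by ring. rewrite Cmod_opp in D.
  apply (Rlt_irrefl (Cmod (h z2))). apply D. unfold q.
  replace ((1 - s)%R * z2 - z2)%C with ((- s)%R * z2)%C by (rewrite RtoC_minus, RtoC_opp; ring).
  rewrite Cmod_mult, Cmod_R, H2, Rabs_Ropp, Rabs_pos_eq by lra. lra.
Qed.

Definition perturb (g : R -> Cx) (eta : R) (b : R -> Cx) (t : R) : Cx :=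
  (fst (g t) + eta * fst (b t), snd (g t) + eta * snd (b t)).

Lemma perturb_derivs (k : ext_nat) (g b : R -> Cx) (eta : R) (dg db : nat -> R -> Cx) :
  derivs k g dg -> derivs k b db ->
  derivs k (perturb g eta b) (fun j => perturb (dg j) eta (db j)).
Proof.
  intros (E & D & K) (E' & D' & K'). split; [|split].
  - rewrite E, E'. reflexivity.
  - intros j Hj t. destruct (D j Hj t) as [D1 D2]. destruct (D' j Hj t) as [D1' D2'].
    split.
    + exact (derivable_pt_lim_plus _ _ t _ _ D1 (derivable_pt_lim_scal _ eta t _ D1')).
    + exact (derivable_pt_lim_plus _ _ t _ _ D2 (derivable_pt_lim_scal _ eta t _ D2')).
  - intros j Hj. destruct (K j Hj) as [K1 K2]. destruct (K' j Hj) as [K1' K2'].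
    split.
    + exact (continuity_plus _ _ K1 (continuity_scal _ eta K1')).
    + exact (continuity_plus _ _ K2 (continuity_scal _ eta K2')).
Qed.

Lemma perturb_Ck (k : ext_nat) (g b : R -> Cx) (eta : R) : Ck k g -> Ck k b ->
  Ck k (perturb g eta b).
Proof.
  intros [P [dg Hg]] [P' [db Hb]]. split.
  - intros t. unfold perturb. rewrite P, P'. reflexivity.
  - exists (fun j => perturb (dg j) eta (db j)). apply perturb_derivs; assumption.
Qed.

Lemma perturb_minus (g b : R -> Cx) (eta : R) (t : R) :
  (perturb g eta b t - g t)%C = (eta * b t)%C.
Proof. unfold perturb. destruct (g t), (b t). unfold Cminus, Cplus, Copp, Cmult. simpl. f_equal; ring. Qed.

Lemma U3_dense (a : Cx) (k : ext_nat) : onT a -> Ck_dense k (U3 a k).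
Proof.
  intros Ha. split; [intros g Hg; apply Hg|]. intros g Hg N eps HN He.
  destruct (classic (exists d h, 0 < d /\ cap_ext a d h g)) as [(d & h & Hd & Hh)|Ng].
  2:{ exists g. split; [apply U3_of_no_cap_ext; assumption|apply near_refl; assumption]. }
  destruct (cexpi_surj a Ha) as [theta Et].
  destruct (bump_bounded_upto theta N) as (B & HB & Hb).
  set (eta := eps / (B + 1)).
  assert (Heta : 0 < eta) by (apply Rdiv_lt_0_compat; lra).
  assert (HetaB : eta * B <= eps).
  { assert (eta * (B + 1) = eps) by (unfold eta; field; lra). lra. }
  exists (perturb g eta (bump theta 0)). split.
  - apply U3_of_no_cap_ext; [exact Ha|apply perturb_Ck; [exact Hg|apply bump_Ck]|].
    intros (d' & h' & Hd' & Hh').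
    set (s := Rmin d d'). assert (Hs : 0 < s) by (apply Rmin_glb_lt; assumption).
    apply (cap_ext_mono _ _ s) in Hh; [|apply Rmin_l].
    apply (cap_ext_mono _ _ s) in Hh'; [|apply Rmin_r].
    destruct Hh as (C1 & D1 & E1). destruct Hh' as (C2 & D2 & E2).
    (* Were both functions extendable, the difference of the extensions divided by [eta] would
       extend the bump. *)
    apply (bump_no_cap_ext theta s (fun z => (/ eta)%R * (h' z - h z))%C Hs).
    rewrite <- Et. split; [|split].
    + apply ccont_on_mult; [|apply ccont_on_minus; assumption].
      apply ccont_ccont_on. intros z _. exact (cdiff_cont _ _ _ (cdiff_const _ z)).
    + intros w Hw. destruct (D1 w Hw) as [l1 L1]. destruct (D2 w Hw) as [l2 L2]. eexists.
      exact (cdiff_mult _ _ w _ _ (cdiff_const (/ eta)%R w) (cdiff_minus _ _ w _ _ L2 L1)).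
    + intros t Ht. rewrite (E1 t Ht), (E2 t Ht), perturb_minus, Cmult_assoc, <- RtoC_mult.
      rewrite Rinv_l by lra. apply Cmult_1_l.
  - intros df dg Hf Hdg j Hj t. change (Cmod (df j t - dg j t) <= eps).
    rewrite (derivs_unique k _ _ _ Hf (perturb_derivs k g _ eta dg _ Hdg (bump_derivs theta k)) j)
      by (apply le_ext_trans with N; assumption).
    rewrite perturb_minus, Cmod_mult, Cmod_R, Rabs_pos_eq by lra.
    apply Rle_trans with (2 := HetaB). apply Rmult_le_compat_l; [lra|apply Hb, Hj].
Qed.

Lemma U3_Gdelta (a : Cx) (k : ext_nat) : onT a -> Ck_Gdelta k (U3 a k).
Proof.
  intros Ha.
  (* The interior of the complement of E n in C^k(T). *)
  exists (fun n g => exists N eps, le_ext N k /\ 0 < eps /\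
    forall f, Ck k f -> near k N eps f g -> ~ bounded_ext a n f).
  split.
  - intros n g Hg (N & eps & HN & He & H). exists N, (eps / 2). split; [exact HN|].
    split; [lra|]. intros f Hf Hfg. exists N, (eps / 2). split; [exact HN|]. split; [lra|].
    intros f' Hf' Hf'f. apply H; [exact Hf'|]. replace eps with (eps / 2 + eps / 2) by field.
    apply near_trans with f; assumption.
  - intros g Hg. split.
    + intros HU n. apply NNPP. intros No.
      (* Outside that interior, every ball of order 0 and radius 1/(j + 1) around [g] meets E n,
         which gives a sequence in E n converging uniformly to [g]. *)
      assert (Ex : forall j, exists f, Ck k f /\ near k 0 (/ (INR j + 1)) f g /\ bounded_ext a n f).
      { intros j. apply NNPP. intros Nf. apply No. exists O, (/ (INR j + 1)).
        split; [apply le_ext_0|].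
        split; [apply Rinv_0_lt_compat; pose proof (pos_INR j); lra|].
        intros f Hf Hfg Hb. apply Nf. exists f. auto. }
      set (f := fun j => proj1_sig (constructive_indefinite_description _ (Ex j))).
      assert (Hf : forall j, Ck k (f j) /\ near k 0 (/ (INR j + 1)) (f j) g /\
        bounded_ext a n (f j)).
      { intros j. exact (proj2_sig (constructive_indefinite_description _ (Ex j))). }
      destruct (bounded_ext_closed a n g f Ha) as (d & h & Hd & Hh).
      * intros j. apply Hf.
      * intros j t. destruct (Hf j) as (F1 & F2 & _). exact (near_dist k _ _ _ t F1 Hg F2).
      * exact (cap_ext_not_U3 a k g d h Ha Hd Hh HU).
    (* An extendable [g] would itself lie in some E n, while it belongs to each of its own
       neighbourhoods. *)
    + intros HO. apply U3_of_no_cap_ext; [exact Ha|exact Hg|].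
      intros (d & h & Hd & Hh).
      destruct (cap_ext_bounded_ext a d h g Ha Hd Hh) as [n Hn].
      destruct (HO n) as (N & eps & HN & He & H).
      exact (H g Hg (near_refl k N eps g HN He) Hn).
Qed.

Theorem theorem3p14 (z0 : Cx) (k : ext_nat) (hz0 : onT z0) :
  Ck_dense k (U3 z0 k) /\ Ck_Gdelta k (U3 z0 k).
Proof.
  split; [exact (U3_dense z0 k hz0)|exact (U3_Gdelta z0 k hz0)].
Qed.
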